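(* Let $\mathcal{D}$ be the distribution $dz_1=\omega_1,\dots,dz_N=\omega_N$ on $(\mathbb{C}^{M+N},0)$, where $M\ge 2$, $N\ge 1$ and $\omega_1,\dots,\omega_N$ are germs at $0\in\mathbb{C}^M$ of holomorphic $1$-forms in the variables $x=(x_1,\dots,x_M)$ only. Let $W_{\mathcal{D}}\subset\mathbb{C}^N$, $\kappa=\operatorname{codim}W_{\mathcal{D}}$ and $H_{\mathcal{D}}$ be as defined in the context. Then a germ $F$ of meromorphic function in $(\mathbb{C}^{M+N},0)$ is a meromorphic first integral of $\mathcal{D}$ if and only if $F=f\circ H_{\mathcal{D}}$ for some germ $f$ of meromorphic function in $(\mathbb{C}^{\kappa},0)$. In particular, if $W_{\mathcal{D}}=\mathbb{C}^N$, the distribution $\mathcal{D}$ has only constant meromorphic first integrals in $(\mathbb{C}^{M+N},0)$.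
   Context: Coordinates on $\mathbb{C}^{M+N}=\mathbb{C}^M\times\mathbb{C}^N$ are $(x,z)=(x_1,\dots,x_M,z_1,\dots,z_N)$. The $\omega_j$ are holomorphic on an open neighborhood $U$ of $0\in\mathbb{C}^M$, and $\mathcal{D}$ is the rank $M$ holomorphic distribution on $U\times\mathbb{C}^N$ whose fiber at $(x,z)$ is $\{(v,w)\in\mathbb{C}^M\times\mathbb{C}^N: w_j=\omega_j(x)(v),\ j=1,\dots,N\}$. A meromorphic first integral of $\mathcal{D}$ is a meromorphic function $F$ whose differential vanishes on $\mathcal{D}$ (where $F$ is holomorphic). Write $\omega=(\omega_1,\dots,\omega_N)$, $d\omega=(d\omega_1,\dots,d\omega_N)$ and expand at $0$: $d\omega=\sum c_K^{ij}x^K\,dx_i\wedge dx_j$, with $c_K^{ij}\in\mathbb{C}^N$, $K\in(\mathbb{Z}_{\ge0})^M$, $1\le i<j\le M$. Let $W_{\mathcal{D}}\subset\mathbb{C}^N$ be the complex vector subspace spanned by all the coefficients $c_K^{ij}$, and $\kappa=\operatorname{codim}W_{\mathcal{D}}$. If $\kappa\ge1$, choose a surjective linear map $T=(T_1,\dots,T_\kappa):\mathbb{C}^N\to\mathbb{C}^\kappa$ with $\ker T=W_{\mathcal{D}}$. Then the forms $T_j(\omega_1,\dots,\omega_N)$ are closed, so there is a unique germ of holomorphic map $g=(g_1,\dots,g_\kappa):(\mathbb{C}^M,0)\to(\mathbb{C}^\kappa,0)$ with $dg_j=T_j(\omega_1,\dots,\omega_N)$, and one sets $H_{\mathcal{D}}(x,z)=T(z)-g(x)$,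 a holomorphic submersion $(\mathbb{C}^M,0)\times\mathbb{C}^N\to\mathbb{C}^\kappa$. If $\kappa=0$, $H_{\mathcal{D}}$ is the constant map to $\mathbb{C}^0$, and by convention the holomorphic (and meromorphic) functions on $(\mathbb{C}^0,0)$ are the constants. *)

(* Defs.v *)
(* The complex numbers are R[i] for R : realType. *)
From HB Require Import structures.
From mathcomp Require Export all_boot all_order all_algebra.
From mathcomp Require Export finmap complex.
From mathcomp Require Export boolp classical_sets reals topology normedtype.
From mathcomp Require Export derive summability.

Set Implicit Arguments.
Unset Strict Implicit.
Unset Printing Implicit Defensive.

Export numFieldNormedType.Exports.
Import Order.TTheory GRing.Theory Num.Theory.

Local Open Scope classical_set_scope.
Local Open Scope ring_scope.

(* R[i] as a normed space over itself, so that 'D_v below is the complex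
   directional derivative. *)
HB.instance Definition _ (R : realType) := NormedModule.copy R[i] R[i]^o.

Section PowerSeries.
Variables (R : realType) (n : nat).
Local Notation C := R[i].

Definition monom (x : 'rV[C]_n) (K : {ffun 'I_n -> nat}) : C :=
  \prod_(i < n) x 0 i ^+ K i.

(* f (a + x) = \sum_K c_K x^K for all x near 0; the sum is unconditional
   (limit along the finite sets of multi-indices), i.e. absolute. *)
Definition has_pseries (f : 'rV[C]_n -> C) (a : 'rV[C]_n)
    (c : {ffun 'I_n -> nat} -> C) : Prop :=
  \forall x \near (0 : 'rV[C]_n),
    partial_sum (fun K => c K * monom x K) @ totally --> f (a + x).

(* Holomorphic in Weierstrass' sense. This is a condition on the germ of f
   at a, and it implies the same condition at every point near a. *)
Definition holomorphic_at (f : 'rV[C]_n -> C) (a : 'rV[C]_n) : Prop :=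
  exists c, has_pseries f a c.

(* A germ at 0 of meromorphic function, i.e. a quotient num / den in the
   fraction field of the ring of germs at 0 of holomorphic functions.
   Functions are representatives of their germs; the equality of two such
   quotients is the cross-multiplied one, which is why it is spelled out in
   each of the definitions below. *)
Record mero_germ : Type := MeroGerm {
  num : 'rV[C]_n -> C;
  den : 'rV[C]_n -> C;
  num_holo : holomorphic_at num 0;
  den_holo : holomorphic_at den 0;
  den_neq0 : ~ (\forall x \near (0 : 'rV[C]_n), den x = 0)
}.

Definition mero_constant (F : mero_germ) : Prop :=
  exists c : C, \forall x \near (0 : 'rV[C]_n), num F x = c * den F x.

(* The germ at y of num F / den F is the germ of holomorphic function h. *)
Definition mero_holo_at (F : mero_germ) (y : 'rV[C]_n) (h : 'rV[C]_n -> C) :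
    Prop :=
  holomorphic_at h y /\ \forall x \near y, num F x = h x * den F x.

End PowerSeries.

(* F = f \o H as germs of meromorphic functions, for H mapping 0 to 0. *)
Definition mero_pullback (R : realType) (n k : nat) (F : mero_germ R n)
    (f : mero_germ R k) (H : 'rV[R[i]]_n -> 'rV[R[i]]_k) : Prop :=
  ~ (\forall y \near (0 : 'rV[R[i]]_n), den f (H y) = 0) /\
  \forall y \near (0 : 'rV[R[i]]_n),
    num F y * den f (H y) = num f (H y) * den F y.

Section Distribution.
Variables (R : realType) (M N : nat).
Local Notation C := R[i].
(* omega x i k is the coefficient of dx_i in omega_k, so that
   omega_k(x)(v) = (v *m omega x) 0 k. *)
Variable omega : 'rV[C]_M -> 'M[C]_(M, N).

Definition holo_forms : Prop :=
  forall i k, holomorphic_at (fun x => omega x i k) 0.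

(* The fibre at y = (x, z), where x = lsubmx y and z = rsubmx y. *)
Definition distribution (y : 'rV[C]_(M + N)) : set 'rV[C]_(M + N) :=
  [set u | rsubmx u = lsubmx u *m omega (lsubmx y)].

Definition first_integral (F : mero_germ R (M + N)) : Prop :=
  \forall y \near (0 : 'rV[C]_(M + N)),
    forall h, mero_holo_at F y h ->
    forall u, distribution y u -> 'D_u h y = 0.

(* The coefficient of dx_i /\ dx_j in d omega_k. *)
Definition dcoef (i j : 'I_M) (k : 'I_N) (x : 'rV[C]_M) : C :=
  'D_(delta_mx 0 i) (fun y => omega y j k) x -
  'D_(delta_mx 0 j) (fun y => omega y i k) x.

(* c K i j is the coefficient of x^K dx_i /\ dx_j in the expansion of
   d omega at 0. *)
Definition dexpansion (c : {ffun 'I_M -> nat} -> 'I_M -> 'I_M -> 'rV[C]_N) :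
    Prop :=
  forall (i j : 'I_M) (k : 'I_N), (i < j)%N ->
    has_pseries (dcoef i j k) 0 (fun K => c K i j 0 k).

(* W is the span of the coefficients c K i j: the least subspace containing
   them. *)
Definition is_WD (W : {vspace 'rV[C]_N}) : Prop :=
  exists c, [/\ dexpansion c,
    forall K (i j : 'I_M), (i < j)%N -> c K i j \in W &
    forall V : {vspace 'rV[C]_N},
      (forall K (i j : 'I_M), (i < j)%N -> c K i j \in V) -> (W <= V)%VS].

Variable kappa : nat.

(* g : (C^M, 0) -> (C^kappa, 0) is holomorphic with
   dg_j = T_j(omega_1, ..., omega_N). *)
Definition is_primitive (T : 'Hom('rV[C]_N, 'rV[C]_kappa))
    (g : 'rV[C]_M -> 'rV[C]_kappa) : Prop :=
  [/\ forall j, holomorphic_at (fun x => g x 0 j) 0,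
      g 0 = 0 &
      \forall x \near (0 : 'rV[C]_M), forall (v : 'rV[C]_M) (j : 'I_kappa),
        'D_v (fun y => g y 0 j) x = T (v *m omega x) 0 j].

Definition HD (T : 'Hom('rV[C]_N, 'rV[C]_kappa))
    (g : 'rV[C]_M -> 'rV[C]_kappa) (y : 'rV[C]_(M + N)) : 'rV[C]_kappa :=
  T (rsubmx y) - g (lsubmx y).

End Distribution.

(* Main.v *)
(* The fields X_i = d/dx_i + \sum_k omega_ik(x) d/dz_k kill a first integral h.
   Their brackets are \sum_k (d omega_k)_ij(x) d/dz_k, and since d/dz_k commutes
   with every X_i, the relations \sum_k c_k(x) (dh/dz_k) = 0 can be differentiated
   in x. So at a point y where h is holomorphic, the functional with coefficients
   (dh/dz_k)(y) kills the whole Taylor expansion of d omega, at x and then, by the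
   identity theorem, at 0: it kills W. In the coordinates (x, z - s(g x)), with s
   a section of T, h is then constant along C^M x W, that is along the fibres of
   H. To get a quotient of germs at 0, choose y1 = (x0, z1) near 0 with
   den F y1 != 0; the affine map sigma t = (x0, z1 + s(t - H y1)) is a section of
   H through y1, f = F o sigma has a nonzero denominator, and the holomorphic
   function num F * den F(sigma o H) - num F(sigma o H) * den F, which vanishes
   near y1, vanishes near 0.
   Power series are handled through the weighted l1 norms \sum_K |d_K| r^|K|:
   they are submultiplicative, so products, inverses and compositions all reduce
   to the exchange of two absolutely convergent sums. *)
From HB Require Import structures.
Require Import Defs.
From mathcomp Require Import functions ring lra.
From mathcomp Require interval_inference landau.
Set Implicit Arguments.
Unset Strict Implicit.
Unset Printing Implicit Defensive.
Import Order.TTheory GRing.Theory Num.Theory.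
Local Open Scope classical_set_scope.
Local Open Scope ring_scope.

Local Arguments real_complex_def : simpl never.

(** * Unconditional sums *)

(** The germ [F] may have no value at 0, and [h] is holomorphic only near points close to 0 that are
    not known in advance. The differential arguments therefore take place at [y1], and whatever must
    be carried back to 0 needs a radius chosen before [y1]. For the Taylor expansion of d omega such
    a radius exists because the functional enters only through constant coefficients: a combination
    of the (d omega_k)_ij converges wherever all of them do, whatever the coefficients. For the
    final identity it exists because [y1] enters sigma only through small constants. The l1 norms
    are preferred to sup norms because they behave well under substitution: if every G_i has norm at
    most rho, then F o G has norm at most that of F at radius rho, without any integral formula or
    Cauchy estimate. The price is paid at differentiation, where no explicit constant is produced:
    the bound comes from the fact that an unconditionally convergent family of complex numbers is
    absolutely summable. *)

Section Modulus.
Variable R : realType.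
Local Notation C := R[i].

(* The modulus as an element of [R], where linear arithmetic is available. *)
Definition nrm (z : C) : R := ComplexField.Normc.normc z.

Lemma nrmE (z : C) : `|z| = (nrm z)%:C%C. Proof. by []. Qed.

Lemma nrm_ge0 (z : C) : 0 <= nrm z.
Proof. by rewrite -lecR -nrmE normr_ge0. Qed.

Lemma nrmD (z w : C) : nrm (z + w) <= nrm z + nrm w.
Proof. by rewrite -lecR raddfD /= -!nrmE ler_normD. Qed.

Lemma nrmM (z w : C) : nrm (z * w) = nrm z * nrm w.
Proof. exact: ComplexField.Normc.normcM. Qed.

Lemma nrmN (z : C) : nrm (- z) = nrm z.
Proof. by apply: complexI; rewrite /= -!nrmE normrN. Qed.

Lemma nrmBC (z w : C) : nrm (z - w) = nrm (w - z).
Proof. by rewrite -nrmN opprB. Qed.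

Lemma nrm0 : nrm 0 = 0.
Proof. by apply: complexI; rewrite -nrmE normr0. Qed.

Lemma nrm1 : nrm 1 = 1.
Proof. by apply: complexI; rewrite -nrmE normr1. Qed.

Lemma nrm_eq0 (z : C) : nrm z = 0 -> z = 0.
Proof. by move=> z0; apply/normr0_eq0; rewrite nrmE z0. Qed.

Lemma nrmX (z : C) n : nrm (z ^+ n) = nrm z ^+ n.
Proof. by elim: n => [|n IH]; rewrite ?expr0 ?nrm1 // !exprS nrmM IH. Qed.

Lemma nrm_real (x : R) : 0 <= x -> nrm x%:C%C = x.
Proof. by move=> x0; apply: complexI; rewrite -nrmE ger0_norm // ler0c. Qed.

Lemma nrm_sum (I : Type) (s : seq I) (a : I -> C) :
  nrm (\sum_(i <- s) a i) <= \sum_(i <- s) nrm (a i).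
Proof.
elim: s => [|i s IH]; first by rewrite !big_nil nrm0.
by rewrite !big_cons (le_trans (nrmD _ _)) // lerD2l.
Qed.

Lemma nrm_prod (I : finType) (a : I -> C) :
  nrm (\prod_i a i) = \prod_i nrm (a i).
Proof. by apply: (big_morph nrm nrmM nrm1). Qed.

Lemma nrm_ge_Re (z : C) : `|complex.Re z| <= nrm z.
Proof. by rewrite -lecR -nrmE normc_ge_Re. Qed.

Lemma nrm_ge_Im (z : C) : `|complex.Im z| <= nrm z.
Proof.
suff -> : `|complex.Im z| = `|complex.Re (z * 'i%C)|.
  by rewrite (le_trans (nrm_ge_Re _)) // nrmM /nrm /= expr0n expr1n add0r sqrtr1 mulr1.
by rewrite ReiNIm normrN.
Qed.

Lemma nrm_le_ReIm (z : C) : nrm z <= `|complex.Re z| + `|complex.Im z|.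
Proof.
rewrite {1}(complexE z) (le_trans (nrmD _ _)) // nrmM.
have -> : nrm 'i%C = 1 by rewrite /nrm /= expr0n expr1n add0r sqrtr1.
by rewrite mul1r lerD // /nrm /= expr0n addr0 sqrtr_sqr.
Qed.

End Modulus.

#[local] Existing Instance totally_filter.

Section Sums.
Variable R : realType.
Local Notation C := R[i].

(** The convergence used in [has_pseries], with a real tolerance in place of a positive element of
    [C]. *)
Definition sums (I : choiceType) (a : I -> C) (l : C) : Prop :=
  forall e : R, 0 < e -> exists A : {fset I}, forall B : {fset I},
    (A `<=` B)%fset -> nrm (\sum_(i <- B) a i - l) < e.

Definition absb (I : choiceType) (a : I -> C) (b : R) : Prop :=
  forall A : {fset I}, \sum_(i <- A) nrm (a i) <= b.

Lemma partial_sumE (I : choiceType) (a : I -> C) A :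
  partial_sum a A = \sum_(i <- A) a i.
Proof. by rewrite big_seq_fsetE. Qed.

Lemma sumsP (I : choiceType) (a : I -> C) l :
  partial_sum a @ totally --> l <-> sums a l.
Proof.
split=> [/cvgrPdist_lt al e e0|al].
  have ec0 : 0 < e%:C%C :> C by rewrite ltcE /= eqxx.
  have [A _ AP] := al _ ec0.
  exists A => B AB; have := AP B AB; rewrite /= nrmE ltcR nrmBC.
  by rewrite partial_sumE.
apply/cvgrPdist_lt => e e0.
have eE : e = (complex.Re e)%:C%C.
  by case: e e0 => x y; rewrite ltcE /= => /andP[/eqP -> _].
have [|A AP] := al (complex.Re e); first by rewrite -ltcR -eE.
exists A => // B AB; have := AP B AB; rewrite /= nrmBC => ?.
by rewrite eE nrmE ltcR partial_sumE.
Qed.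

Lemma sums_uniq (I : choiceType) (a : I -> C) l m :
  sums a l -> sums a m -> l = m.
Proof.
move=> al am; apply/eqP; rewrite -subr_eq0; apply/eqP/nrm_eq0/eqP.
apply/negPn/negP => lm; have e0 : 0 < nrm (l - m) / 2.
  by rewrite divr_gt0 // lt_neqAle eq_sym lm nrm_ge0.
have [A AP] := al _ e0; have [B BP] := am _ e0.
have h1 := AP (A `|` B)%fset (fsubsetUl _ _).
have h2 := BP (A `|` B)%fset (fsubsetUr _ _).
move: h1 h2; set S := \sum_(i <- _) a i => h1 h2.
by have := nrmD (l - S) (S - m); rewrite addrA subrK (nrmBC l S); lra.
Qed.

Lemma sumsD (I : choiceType) (a b : I -> C) l m :
  sums a l -> sums b m -> sums (fun i => a i + b i) (l + m).
Proof.
move=> al bm e e0; have e20 : 0 < e / 2 by rewrite divr_gt0.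
have [A AP] := al _ e20; have [B BP] := bm _ e20.
exists (A `|` B)%fset => D; rewrite fsubUset => /andP[AD BD].
have h1 := AP D AD; have h2 := BP D BD.
rewrite big_split /= opprD addrACA (le_lt_trans (nrmD _ _)) //; move: h1 h2; lra.
Qed.

Lemma sumsZ (I : choiceType) (a : I -> C) c l :
  sums a l -> sums (fun i => c * a i) (c * l).
Proof.
move=> al e e0; have c0 : 0 < nrm c + 1 by rewrite ltr_wpDl ?nrm_ge0.
have [|A AP] := al (e / (nrm c + 1)); first by rewrite divr_gt0.
exists A => B AB; rewrite -mulr_sumr -mulrBr nrmM.
have := AP B AB; rewrite ltr_pdivlMr // => h.
rewrite (le_lt_trans _ h) // mulrC ler_wpM2l ?nrm_ge0 //; lra.
Qed.

Lemma eq_sums (I : choiceType) (a b : I -> C) l :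
  a =1 b -> sums a l -> sums b l.
Proof. by move=> /funext ->. Qed.

Lemma sums_single (I : choiceType) (i : I) (a : I -> C) :
  (forall j, j != i -> a j = 0) -> sums a (a i).
Proof.
move=> a0 e e0; exists [fset i]%fset => B; rewrite fsub1set => iB.
rewrite (big_fsetD1 i) //= big1_seq ?addr0 ?subrr ?nrm0 // => j /=.
by rewrite !inE => /andP[ji _]; exact: a0.
Qed.

Lemma sums_le (I : choiceType) (a : I -> C) l b :
  absb a b -> sums a l -> nrm l <= b.
Proof.
move=> ab al; apply/ler_addgt0Pr => e e0; have [A AP] := al e e0.
have h := AP A (fsubset_refl A); have h2 := ab A; have h3 := nrm_sum A a.
move: h h2 h3; set S := \sum_(i <- A) a i => h h2 h3.
by have := nrmD (l - S) S; rewrite subrK (nrmBC l S); lra.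
Qed.

Lemma absb_ge0 (I : choiceType) (a : I -> C) b : absb a b -> 0 <= b.
Proof. by move=> /(_ fset0); rewrite big_seq_fset0. Qed.

Lemma absb_le (I : choiceType) (a a' : I -> C) b :
  absb a b -> (forall i, nrm (a' i) <= nrm (a i)) -> absb a' b.
Proof.
by move=> ab aa' A; rewrite (le_trans _ (ab A)) // ler_sum // => i _.
Qed.

Lemma absb1 (I : choiceType) (a : I -> C) b i : absb a b -> nrm (a i) <= b.
Proof. by move=> /(_ [fset i]%fset); rewrite big_seq_fset1. Qed.

Lemma ler_sum_fset (I : choiceType) (f : I -> R) (A B : {fset I}) :
  (forall i, 0 <= f i) -> (A `<=` B)%fset ->
  \sum_(i <- A) f i <= \sum_(i <- B) f i.
Proof.
move=> f0 AB; rewrite [leRHS](big_fsetID _ (mem A)) /=.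
have -> : [fset x in B | x \in A]%fset = A.
  apply/fsetP => i; rewrite !inE /=; apply: andb_idl.
  exact: (fsubsetP AB).
by rewrite lerDl sumr_ge0.
Qed.

Lemma sums_real (I : choiceType) (f : I -> R) b :
  (forall i, 0 <= f i) -> (forall A : {fset I}, \sum_(i <- A) f i <= b) ->
  exists s : R, sums (fun i => (f i)%:C%C) s%:C%C.
Proof.
move=> f0 fb; pose S := [set \sum_(i <- A) f i | A in [set: {fset I}]].
have Ssup : has_sup S.
  by split; [exists (\sum_(i <- fset0) f i), fset0|exists b => _ [A _ <-]].
exists (sup S) => e e0.
have [_ [A _ <-] hA] := sup_adherent e0 Ssup.
exists A => B AB; rewrite nrmBC.
have -> : (sup S)%:C%C - \sum_(i <- B) (f i)%:C%C =
    (sup S - \sum_(i <- B) f i)%:C%C by rewrite rmorphB rmorph_sum.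
have hB : \sum_(i <- B) f i <= sup S by apply: ub_le_sup; [case: Ssup|exists B].
have hAB := ler_sum_fset f0 AB.
by rewrite nrm_real ?subr_ge0 //; move: hA hAB; lra.
Qed.

(** The families |a| + Re a and |a| + Im a are nonnegative with finite sums at most 2b, so each has
    its supremum as sum; subtracting the sum of the moduli recovers the real and imaginary parts. *)
Lemma absb_sums (I : choiceType) (a : I -> C) b :
  absb a b -> exists l, sums a l.
Proof.
move=> ab.
have Re0 i : 0 <= nrm (a i) + complex.Re (a i).
  by have := nrm_ge_Re (a i); rewrite ler_norml; lra.
have Im0 i : 0 <= nrm (a i) + complex.Im (a i).
  by have := nrm_ge_Im (a i); rewrite ler_norml; lra.
have [u hu] := sums_real (fun i => nrm_ge0 (a i)) ab.
have [|v hv] := @sums_real _ (fun i => nrm (a i) + complex.Re (a i)) (b + b) Re0.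
  move=> A; rewrite big_split /= lerD // (le_trans _ (ab A)) // ler_sum // => i _.
  by rewrite (le_trans (ler_norm _)) // nrm_ge_Re.
have [|w hw] := @sums_real _ (fun i => nrm (a i) + complex.Im (a i)) (b + b) Im0.
  move=> A; rewrite big_split /= lerD // (le_trans _ (ab A)) // ler_sum // => i _.
  by rewrite (le_trans (ler_norm _)) // nrm_ge_Im.
have hu' := sumsZ (-1) hu.
exists ((v%:C%C + -1 * u%:C%C) + 'i%C * (w%:C%C + -1 * u%:C%C)).
apply: eq_sums (sumsD (sumsD hv hu') (sumsZ 'i%C (sumsD hw hu'))) => i /=.
by rewrite !mulN1r -!raddfB /= !(addrC (nrm _)) !addrK -complexE.
Qed.

(** Beyond a finite set A, the sum over any finite set disjoint from A is a difference of two
    quantities of modulus less than 1. Splitting such a set by the sign of the real part turns this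
    into a bound on the absolute values, 2 for each sign. Applied to a and to i a, it shows that
    unconditional convergence is absolute. *)
Lemma sums_Re_bound (I : choiceType) (a : I -> C) l :
  sums a l -> exists b, forall A : {fset I},
    \sum_(i <- A) `|complex.Re (a i)| <= b.
Proof.
move=> al; have [A AP] := al 1 ltr01.
have disj (F : {fset I}) : (forall i, i \in F -> i \notin A) ->
    nrm (\sum_(i <- F) a i) <= 2.
  move=> FA; have h1 := AP A (fsubset_refl A).
  have := AP (A `|` F)%fset (fsubsetUl _ _).
  rewrite (big_fsetID _ (mem A)) /=.
  have -> : [fset x in (A `|` F) | x \in A]%fset = A.
    by apply/fsetP => i; rewrite !inE /=; case: (i \in A) => //=; rewrite andbF.
  have -> : [fset x in (A `|` F) | x \notin A]%fset = F.
    apply/fsetP => i; rewrite !inE /=; case: (boolP (i \in F)) => [/FA ->|_].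
      by rewrite orbT.
    by rewrite orbF andbN.
  move: h1; set SA := \sum_(i <- A) a i; set SF := \sum_(i <- F) a i => h1 h2.
  have -> : SF = (SA + SF - l) - (SA - l) by ring.
  by rewrite (le_trans (nrmD _ _)) // nrmN; lra.
exists (\sum_(i <- A) `|complex.Re (a i)| + (2 + 2)) => F.
rewrite (big_fsetID _ (mem A)) /= lerD //.
  apply: ler_sum_fset => [i|]; first exact: normr_ge0.
  by apply/fsubsetP => i; rewrite !inE /= => /andP[].
set G := [fset x in F | x \notin A]%fset.
have GA i : i \in G -> i \notin A by rewrite !inE => /andP[].
rewrite (big_fsetID _ (fun i => 0 <= complex.Re (a i))) /= lerD //.
  rewrite (eq_big_seq (fun i => complex.Re (a i))).
    rewrite -(raddf_sum (@complex.Re R : {additive Rcomplex R -> R})) /=.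
    rewrite (le_trans (ler_norm _)) // (le_trans (nrm_ge_Re _)) // disj // => i.
    by rewrite !inE /= => /andP[/andP[]].
  by move=> i; rewrite !inE /= => /andP[_ ?]; rewrite ger0_norm.
rewrite (eq_big_seq (fun i => - complex.Re (a i))).
  rewrite sumrN -(raddf_sum (@complex.Re R : {additive Rcomplex R -> R})) /=.
  rewrite (le_trans (ler_norm _)) // normrN (le_trans (nrm_ge_Re _)) // disj // => i.
  by rewrite !inE /= => /andP[/andP[]].
by move=> i; rewrite !inE /= -ltNge => /andP[_ ?]; rewrite ltr0_norm.
Qed.

Lemma sums_absb (I : choiceType) (a : I -> C) l :
  sums a l -> exists b, absb a b.
Proof.
move=> al; have [b1 h1] := sums_Re_bound al.
have [b2 h2] := sums_Re_bound (sumsZ 'i%C al).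
exists (b1 + b2) => A.
rewrite (le_trans _ (lerD (h1 A) (h2 A))) // -big_split /= ler_sum // => i _.
by rewrite (le_trans (nrm_le_ReIm _)) // lerD2l mulrC ReiNIm normrN.
Qed.

Lemma big_fsetM (V : nmodType) (I J : choiceType) (A : {fset I}) (B : {fset J})
    (F : I * J -> V) :
  \sum_(p <- (A `*` B)%fset) F p = \sum_(i <- A) \sum_(j <- B) F (i, j).
Proof.
transitivity (\sum_(p <- [seq (i, j) | i <- A, j <- B]) F p);
  last by rewrite big_allpairs_dep.
apply: perm_big; apply: uniq_perm; first exact: fset_uniq.
  by apply: allpairs_uniq; rewrite ?fset_uniq // => -[? ?] [? ?] _ _ [-> ->].
move=> [i j]; rewrite in_fsetM /=; apply/andP/allpairsP => /=.
  by move=> [iA jB]; exists (i, j).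
by move=> [[i' j'] [? ? [-> ->]]].
Qed.

(** For a finite set I' of rows, one finite set of columns can be taken past the thresholds of all
    these rows and of the double family, so the row sums over I' are compared with S through a
    rectangle. *)
Lemma sums_fibers (I J : choiceType) (a : I * J -> C) (s : I -> C) S :
  sums a S -> (forall i, sums (fun j => a (i, j)) (s i)) -> sums s S.
Proof.
move=> aS as_ e e0; have e20 : 0 < e / 2 by rewrite divr_gt0.
have [A AP] := aS _ e20; exists [fset p.1 | p in A]%fset => I' AI.
have n0 : 0 < (size (enum_fset I'))%:R + 1 :> R by rewrite ltr_wpDl.
(* The rows of I' together err by at most e / 2; adding 1 keeps d positive when I' is empty. *)
pose d := e / 2 / ((size (enum_fset I'))%:R + 1).
have d0 : 0 < d by rewrite !divr_gt0.
have /choice[L LP] : forall i, exists L : {fset J}, forall B : {fset J},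
    (L `<=` B)%fset -> nrm (\sum_(j <- B) a (i, j) - s i) < d.
  by move=> i; exact: as_.
pose B := (\bigcup_(i <- I') L i `|` [fset p.2 | p in A])%fset.
have hB : (A `<=` I' `*` B)%fset.
  apply/fsubsetP => p pA; rewrite in_fsetM /= inE; apply/andP; split.
    by apply: (fsubsetP AI); apply/imfsetP; exists p.
  by apply/orP; right; apply/imfsetP; exists p.
have := AP _ hB; rewrite big_fsetM => h1.
have h2 : nrm (\sum_(i <- I') (\sum_(j <- B) a (i, j) - s i)) <= e / 2.
  rewrite (le_trans (nrm_sum _ _)) //.
  rewrite (@le_trans _ _ (\sum_(i <- I') d)) //.
    rewrite big_seq [leRHS]big_seq ler_sum // => i iI; apply/ltW/LP.
    by rewrite (fsubset_trans _ (fsubsetUl _ _)) // bigfcup_sup.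
  rewrite big_const_seq count_predT iter_addr_0 -[leLHS]mulr_natl /d mulrA ler_pdivrMr //.
  by rewrite mulrC ler_wpM2l // ?ltW //; lra.
have -> : \sum_(i <- I') s i - S =
    (\sum_(i <- I') \sum_(j <- B) a (i, j) - S) -
     \sum_(i <- I') (\sum_(j <- B) a (i, j) - s i).
  rewrite sumrB; ring.
by rewrite (le_lt_trans (nrmD _ _)) // nrmN; move: h1 h2; lra.
Qed.

Lemma absb_fibers (I J : choiceType) (a : I * J -> C) (b : I -> R) B :
  (forall i, absb (fun j => a (i, j)) (b i)) ->
  (forall A : {fset I}, \sum_(i <- A) b i <= B) -> absb a B.
Proof.
move=> ab bB A; pose A1 := [fset p.1 | p in A]%fset.
pose A2 := [fset p.2 | p in A]%fset.
rewrite (@le_trans _ _ (\sum_(p <- (A1 `*` A2)%fset) nrm (a p))) //.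
  apply: ler_sum_fset => [p|]; first exact: nrm_ge0.
  by apply/fsubsetP => p pA; rewrite in_fsetM; apply/andP; split;
    apply/imfsetP; exists p.
by rewrite big_fsetM (le_trans _ (bB A1)) // ler_sum // => i _; exact: ab.
Qed.

Section Reindex.
Variables (I J : choiceType) (phi : I -> J) (psi : J -> option I).
Hypotheses (phiK : pcancel phi psi) (psiK : ocancel psi phi).

Let inj : injective phi := pcan_inj phiK.

Let big_phi (a : J -> C) (B : {fset I}) :
  \sum_(j <- [fset phi i | i in B]%fset) a j = \sum_(i <- B) a (phi i).
Proof. by rewrite big_imfset //= => i j _ _; exact: inj. Qed.

Let pre (A : {fset J}) : {fset I} := [fset i in pmap psi (enum_fset A)]%fset.

Let mem_pre A i : (i \in pre A) = (phi i \in A).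
Proof.
rewrite in_fset /= mem_pmap; apply/mapP/idP => [[j jA]|phiA]; last first.
  by exists (phi i); rewrite ?phiK.
by move=> /esym ji; have := psiK j; rewrite ji /= => ->.
Qed.

(** The condition through [psi] says that a vanishes off the image of [phi]. Besides swapping the
    factors of a product, the reindexings of interest are the shift of an exponent by [incr i] and
    the successor on [nat]. *)
Lemma sums_pull (a : J -> C) l :
  (forall j, psi j = None -> a j = 0) -> sums a l -> sums (a \o phi) l.
Proof.
move=> a0 al e e0; have [A AP] := al e e0; exists (pre A) => B AB.
have := AP (A `|` [fset phi i | i in B])%fset (fsubsetUl _ _).
rewrite -big_phi; congr (nrm (_ - _) < _); symmetry; apply: big_fset_incl.
  exact: fsubsetUr.
move=> j; rewrite inE => /orP[jA|-> //] jB.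
apply: a0; case E: (psi j) => [i|//]; have := psiK j; rewrite E /= => ji.
move: jB; rewrite -ji => /negP[]; apply/imfsetP; exists i => //.
by apply: (fsubsetP AB); rewrite mem_pre ji.
Qed.

Lemma sums_push (a : J -> C) l :
  (forall j, psi j = None -> a j = 0) -> sums (a \o phi) l -> sums a l.
Proof.
move=> a0 al e e0; have [A AP] := al e e0.
exists [fset phi i | i in A]%fset => B AB.
have : nrm (\sum_(i <- pre B) a (phi i) - l) < e.
  apply: AP; apply/fsubsetP => i iA; rewrite mem_pre.
  by apply: (fsubsetP AB); apply/imfsetP; exists i.
rewrite -big_phi; congr (nrm (_ - _) < _); apply: big_fset_incl.
  by apply/fsubsetP => _ /imfsetP[i /= + ->]; rewrite mem_pre.
move=> j jB jn; apply: a0; case E: (psi j) => [i|//].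
have := psiK j; rewrite E /= => ji; move/negP: jn; case.
by apply/imfsetP; exists i => //=; rewrite mem_pre ji.
Qed.

Lemma absb_push (a : J -> C) b :
  (forall j, psi j = None -> a j = 0) -> absb (a \o phi) b -> absb a b.
Proof.
move=> a0 ab A; rewrite (le_trans _ (ab (pre A))) //.
rewrite (big_fsetID _ (fun j => psi j != None)) /=.
rewrite [X in _ + X]big1_seq ?addr0; last first.
  by move=> j /=; rewrite !inE /= negbK => /andP[_ /eqP/a0 ->]; rewrite nrm0.
have -> : \sum_(i <- pre A) nrm ((a \o phi) i) =
    \sum_(j <- [fset phi i | i in pre A]%fset) nrm (a j).
  by rewrite [RHS]big_imfset //= => i j _ _; exact: inj.
apply: ler_sum_fset => [j|]; first exact: nrm_ge0.
apply/fsubsetP => j; rewrite !inE /= => /andP[jA].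
case E: (psi j) => [i|//] _; have := psiK j; rewrite E /= => ji.
by apply/imfsetP; exists i => //=; rewrite mem_pre ji.
Qed.

End Reindex.

Lemma sums_swap (I J : choiceType) (a : I * J -> C) l :
  sums a l -> sums (fun p => a (p.2, p.1)) l.
Proof.
apply: (@sums_pull _ _ (fun p : J * I => (p.2, p.1))
  (fun q => Some (q.2, q.1))) => //; by case.
Qed.

(** The bound on the rows makes the family summable over I * J, and both iterated sums are equal to
    that double sum. *)
Lemma sums_exchange (I J : choiceType) (a : I -> J -> C) (s : I -> C)
    (t : J -> C) (b : I -> R) B S :
  (forall i, absb (a i) (b i)) ->
  (forall A : {fset I}, \sum_(i <- A) b i <= B) ->
  (forall i, sums (a i) (s i)) -> (forall j, sums (a^~ j) (t j)) ->
  sums s S -> sums t S.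
Proof.
move=> ab bB as_ at_ sS.
have [S' hS'] := absb_sums (@absb_fibers _ _ (fun p => a p.1 p.2) _ _ ab bB).
have <- := sums_uniq (sums_fibers hS' as_) sS.
exact: (sums_fibers (sums_swap hS')).
Qed.

End Sums.

(** * Power series on polydiscs *)

Section MultiIndex.
Variable n : nat.
Local Notation mi := {ffun 'I_n -> nat}.

Implicit Types (K : mi) (i : 'I_n).

Definition mi0 : mi := [ffun=> 0%N].
Definition incr (i : 'I_n) (K : mi) : mi := [ffun j => K j + (j == i)]%N.
(** Truncated subtraction: [decr i] fixes K when K i = 0. The partial inverse of [incr i] is
    [odecr i]. *)
Definition decr (i : 'I_n) (K : mi) : mi := [ffun j => K j - (j == i)]%N.
Definition odecr (i : 'I_n) (K : mi) : option mi :=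
  if K i == 0%N then None else Some (decr i K).
Definition deg (K : mi) : nat := (\sum_i K i)%N.

Lemma incrK i : cancel (incr i) (decr i).
Proof. by move=> K; apply/ffunP => j; rewrite !ffunE addnK. Qed.

Lemma decrK i K : K i != 0%N -> incr i (decr i K) = K.
Proof.
move=> Ki; apply/ffunP => j; rewrite !ffunE subnK //.
by case: eqP => [->|//]; rewrite lt0n.
Qed.

Lemma incr_pcan i : pcancel (incr i) (odecr i).
Proof. by move=> K; rewrite /odecr ffunE eqxx addn1 incrK. Qed.

Lemma odecrK i : ocancel (odecr i) (incr i).
Proof. by move=> K; rewrite /odecr; case: eqP => //= /eqP/decrK. Qed.

Lemma odecr_None i K : odecr i K = None -> K i = 0%N.
Proof. by rewrite /odecr; case: eqP. Qed.

Lemma deg_incr i K : deg (incr i K) = (deg K).+1.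
Proof.
rewrite /deg (eq_bigr (fun j => K j + (j == i))%N) => [|j _]; last by rewrite ffunE.
by rewrite big_split /= -big_mkcond big_pred1_eq /= addn1.
Qed.

Lemma deg_eq0 K : (deg K == 0)%N = (K == mi0).
Proof.
rewrite /deg sum_nat_eq0; apply/forallP/eqP => [K0|-> i]; last by rewrite ffunE.
by apply/ffunP => i; rewrite ffunE; have /eqP := K0 i.
Qed.

Lemma deg_mi0 : deg mi0 = 0%N.
Proof. by apply/eqP; rewrite deg_eq0. Qed.

Lemma mi_ind (P : mi -> Prop) :
  P mi0 -> (forall i K, P K -> P (incr i K)) -> forall K, P K.
Proof.
move=> P0 Pi K; elim: {K}(deg K) {-2}K (erefl (deg K)) => [|m IH] K.
  by move/eqP; rewrite deg_eq0 => /eqP ->.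
move=> dK; have [i Ki|K0] := pickP (fun i => K i != 0%N); last first.
  by move: dK; rewrite /deg big1 // => i _; have /negbFE/eqP := K0 i.
rewrite -(decrK Ki); apply/Pi/IH; apply/eqP; rewrite -eqSS -dK.
by rewrite -{2}(decrK Ki) deg_incr.
Qed.

End MultiIndex.

Section PowerSeries.
Variable R : realType.
Local Notation C := R[i].
Local Notation mi n := {ffun 'I_n -> nat}.

Definition pdisc n (r : R) (x : 'rV[C]_n) : Prop := forall i, nrm (x 0 i) <= r.

Lemma pdiscD n r s (x y : 'rV[C]_n) :
  pdisc r x -> pdisc s y -> pdisc (r + s) (x + y).
Proof. by move=> rx sy i; rewrite mxE (le_trans (nrmD _ _)) // lerD. Qed.

Lemma pdiscN n r (x : 'rV[C]_n) : pdisc r (- x) <-> pdisc r x.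
Proof. by split=> rx i; have := rx i; rewrite mxE nrmN. Qed.

Lemma pdisc_le n r s (x : 'rV[C]_n) : r <= s -> pdisc r x -> pdisc s x.
Proof. by move=> rs rx i; rewrite (le_trans (rx i)). Qed.

Lemma pdisc0 n r : 0 <= r -> pdisc r (0 : 'rV[C]_n).
Proof. by move=> r0 i; rewrite mxE nrm0. Qed.

Lemma real_pos (e : C) : 0 < e -> e = (complex.Re e)%:C%C /\ 0 < complex.Re e.
Proof. by case: e => x y; rewrite ltcE /= => /andP[/eqP -> ?]. Qed.

Lemma nearP n (a : 'rV[C]_n) (P : 'rV[C]_n -> Prop) :
  (\forall x \near a, P x) <->
  exists2 r : R, 0 < r & forall x, pdisc r x -> P (a + x).
Proof.
split=> [/nbhs_ballP[e /= /real_pos[-> e0] eP]|[r r0 rP]].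
  (* Half the radius, because balls are open and polydiscs closed. *)
  exists (complex.Re e / 2); first by rewrite divr_gt0.
  move=> x rx; apply: eP; split => [|i j]; first by rewrite ltcE /= eqxx.
  rewrite (ord1 i) mxE; have := rx j; rewrite -ball_normE /= opprD addNKr.
  by rewrite normrN nrmE ltcR; move: e0; set s := complex.Re e; lra.
have rc0 : 0 < r%:C%C :> C by rewrite ltcE /= eqxx.
apply/nbhs_ballP; exists r%:C%C => // y [_ ry].
rewrite -(subrK a y) addrC; apply: rP => i.
have := ry 0 i; rewrite -ball_normE /= -normrN opprB !mxE nrmE ltcR.
exact: ltW.
Qed.

Lemma near_shift0 n (a : 'rV[C]_n) (P : 'rV[C]_n -> Prop) :
  (\forall x \near a, P x) <-> \forall x \near (0 : 'rV[C]_n), P (a + x).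
Proof.
rewrite !nearP; split=> -[r r0 rP]; exists r => // x /rP; by rewrite add0r.
Qed.

Lemma nrm_monom n (x : 'rV[C]_n) K r :
  pdisc r x -> nrm (monom x K) <= r ^+ deg K.
Proof.
move=> rx; rewrite nrm_prod /deg -prodrXr ler_prod // => i _.
by rewrite nrm_ge0 nrmX /= lerXn2r ?nnegrE ?nrm_ge0 // (le_trans (nrm_ge0 _) (rx i)).
Qed.

Lemma monom0 n (x : 'rV[C]_n) : monom x (mi0 n) = 1.
Proof. by rewrite /monom big1 // => i _; rewrite ffunE. Qed.

Lemma monom_incr n (x : 'rV[C]_n) i K : monom x (incr i K) = x 0 i * monom x K.
Proof.
rewrite /monom (eq_bigr (fun j => x 0 j ^+ (j == i) * x 0 j ^+ K j)).
  rewrite big_split /=; congr (_ * _).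
  by rewrite (bigD1 i) //= eqxx expr1 big1 ?mulr1 // => j /negbTE ->.
by move=> j _; rewrite ffunE -exprD addnC.
Qed.

Lemma monom_real n (r : R) (K : mi n) :
  monom (const_mx r%:C%C) K = r%:C%C ^+ deg K.
Proof. by rewrite /deg -prodrXr; apply: eq_bigr => i _; rewrite mxE. Qed.

Lemma monom0l n (K : mi n) : K != mi0 n -> monom (0 : 'rV[C]_n) K = 0.
Proof.
move: K; apply: mi_ind => [|i K _ _]; first by rewrite eqxx.
by rewrite monom_incr mxE mul0r.
Qed.

Section Ana.
Variable n : nat.
Implicit Types (f g : 'rV[C]_n -> C) (d : mi n -> C) (r B : R).

(* [B] bounds the l1 norm of the coefficients with the weights [r ^+ deg K],
   not just the function. *)
Definition anac r B f d : Prop :=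
  absb (fun K => d K * r%:C%C ^+ deg K) B /\
  forall x, pdisc r x -> sums (fun K => d K * monom x K) (f x).

Definition ana r B f : Prop := exists d, anac r B f d.

Lemma nrm_weight d r K : 0 <= r ->
  nrm (d K * r%:C%C ^+ deg K) = nrm (d K) * r ^+ deg K.
Proof. by move=> r0; rewrite nrmM nrmX nrm_real. Qed.

Lemma anac_le r r' B B' f d : 0 <= r' -> r' <= r -> B <= B' ->
  anac r B f d -> anac r' B' f d.
Proof.
move=> r'0 r'r BB' [dB df]; split=> [A|x r'x]; last exact/df/(pdisc_le r'r).
apply: le_trans (le_trans _ (dB A)) BB'; apply: ler_sum => K _.
have r0 := le_trans r'0 r'r.
by rewrite !nrm_weight // ler_wpM2l ?nrm_ge0 // lerXn2r.
Qed.

Lemma ana_le r r' B B' f : 0 <= r' -> r' <= r -> B <= B' ->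
  ana r B f -> ana r' B' f.
Proof. by move=> ? ? ? [d df]; exists d; exact: anac_le df. Qed.

Lemma eq_anac r B f g d : (forall x, pdisc r x -> f x = g x) ->
  anac r B f d -> anac r B g d.
Proof. by move=> fg [dB df]; split=> // x rx; rewrite -fg //; exact: df. Qed.

Lemma eq_ana r B f g : (forall x, pdisc r x -> f x = g x) ->
  ana r B f -> ana r B g.
Proof. by move=> fg [d df]; exists d; exact: eq_anac df. Qed.

Lemma ana_ge0 r B f : ana r B f -> 0 <= B.
Proof. by case=> d [/absb_ge0]. Qed.

Lemma absb_monom r B d x : absb (fun K => d K * r%:C%C ^+ deg K) B ->
  0 <= r -> pdisc r x -> absb (fun K => d K * monom x K) B.
Proof.
move=> dB r0 rx; apply: absb_le dB _ => K; rewrite nrm_weight // nrmM.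
by rewrite ler_wpM2l ?nrm_ge0 // nrm_monom.
Qed.

Lemma ana_bound r B f x : 0 <= r -> ana r B f -> pdisc r x -> nrm (f x) <= B.
Proof.
by move=> r0 [d [dB df]] rx; exact: sums_le (absb_monom dB r0 rx) (df x rx).
Qed.

Lemma absb_single (I : choiceType) (i : I) (a : I -> C) :
  (forall j, j != i -> a j = 0) -> absb a (nrm (a i)).
Proof.
move=> a0 A; case: (boolP (i \in A)) => iA; last first.
  rewrite big1_seq ?nrm_ge0 // => j /= jA; rewrite a0 ?nrm0 //.
  by apply: contraNneq iA => <-.
rewrite (big_fsetD1 i) //= big1_seq ?addr0 // => j /=.
by rewrite !inE => /andP[/a0 -> _]; rewrite nrm0.
Qed.

Lemma ana_cst r c : ana r (nrm c) (fun=> c).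
Proof.
exists (fun K => if K == mi0 n then c else 0); split=> [|x _].
  set a := (X in absb X).
  suff -> : nrm c = nrm (a (mi0 n)) by apply: absb_single => K /negbTE K0;
    rewrite /a K0 mul0r.
  by rewrite /a eqxx deg_mi0 mulr1.
set a := (X in sums X).
suff -> : c = a (mi0 n) by apply: sums_single => K /negbTE K0; rewrite /a K0 mul0r.
by rewrite /a eqxx monom0 mulr1.
Qed.

Lemma anaD r B B' f g : ana r B f -> ana r B' g ->
  ana r (B + B') (fun x => f x + g x).
Proof.
move=> [d [dB df]] [e [eB eg]]; exists (fun K => d K + e K); split=> [A|x rx].
  rewrite (le_trans _ (lerD (dB A) (eB A))) // -big_split /= ler_sum // => K _.
  by rewrite mulrDl nrmD.
by apply: eq_sums (sumsD (df x rx) (eg x rx)) => K; rewrite mulrDl.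
Qed.

Lemma ana_mulX r B f i : 0 <= r -> ana r B f ->
  ana r (r * B) (fun x => x 0 i * f x).
Proof.
move=> r0 [d [dB df]].
pose e K := if odecr i K is Some L then d L else 0.
have eN K : odecr i K = None -> e K = 0 by rewrite /e => ->.
have eS L : e (incr i L) = d L by rewrite /e incr_pcan.
exists e; split=> [|x rx].
  apply: (absb_push (incr_pcan i) (@odecrK n i)) => [K /eN ->|A].
    by rewrite mul0r.
  rewrite (le_trans _ (ler_wpM2l r0 (dB A))) // mulr_sumr ler_sum // => L _ /=.
  by rewrite eS deg_incr exprS mulrCA [leLHS]nrmM nrm_real.
apply: (sums_push (incr_pcan i) (@odecrK n i)) => [K /eN ->|].
  by rewrite mul0r.
by apply: eq_sums (sumsZ (x 0 i) (df x rx)) => L /=; rewrite eS monom_incr mulrCA.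
Qed.

Lemma ana_mulXn r B f i k : 0 <= r -> ana r B f ->
  ana r (r ^+ k * B) (fun x => x 0 i ^+ k * f x).
Proof.
move=> r0 fB; elim: k => [|k IH].
  by rewrite expr0 mul1r; apply: eq_ana fB => x _; rewrite expr0 mul1r.
rewrite exprS -mulrA; apply: eq_ana (ana_mulX i r0 IH) => x _.
by rewrite exprS mulrA.
Qed.

Lemma ana_mul_monom r B f K : 0 <= r -> ana r B f ->
  ana r (r ^+ deg K * B) (fun x => monom x K * f x).
Proof.
move=> r0 fB; rewrite /deg /monom -prodrXr.
elim: (index_enum _) => [|i s IH].
  by rewrite big_nil mul1r; apply: eq_ana fB => x _; rewrite big_nil mul1r.
rewrite big_cons -mulrA; apply: eq_ana (ana_mulXn i (K i) r0 IH) => x _.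
by rewrite big_cons mulrA.
Qed.

(** The moduli of column j have a sum u j that dominates |t j|, and a finite sum of the u j is a sum
    over i of partial row sums, each at most b i. This is the counterpart of [sums_exchange] for
    bounds, and it keeps the constant B. *)
Lemma absb_exchange (I J : choiceType) (a : I -> J -> C) (t : J -> C)
    (b : I -> R) B :
  (forall i, absb (a i) (b i)) ->
  (forall A : {fset I}, \sum_(i <- A) b i <= B) ->
  (forall j, sums (a^~ j) (t j)) -> absb t B.
Proof.
move=> ab bB at_ A.
have u j : exists u : R, sums (fun i => (nrm (a i j))%:C%C) u%:C%C.
  apply: (@sums_real _ _ _ B) => [i|D]; first exact: nrm_ge0.
  by rewrite (le_trans _ (bB D)) // ler_sum // => i _; exact: absb1.
have {u}/choice[u uP] := u.
have tu j : nrm (t j) <= u j.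
  have ub (D : {fset I}) : \sum_(i <- D) nrm (a i j) <= u j.
    apply/ler_addgt0Pr => e e0; have [A0 AP] := uP j e e0.
    have := AP (A0 `|` D)%fset (fsubsetUl _ _).
    rewrite -rmorph_sum -rmorphB /=.
    have := @ler_sum_fset R _ (fun i => nrm (a i j)) D (A0 `|` D)%fset
      (fun=> nrm_ge0 _) (fsubsetUr _ _).
    set s1 := \sum_(i <- D) _; set s2 := \sum_(i <- (_ `|` _)%fset) _.
    by have := nrm_ge_Re (s2 - u j)%:C%C; rewrite ler_norml /=; lra.
  exact: sums_le ub (at_ j).
rewrite (le_trans (ler_sum _ (fun j _ => tu j))) //.
have us (s : seq J) : sums (fun i => (\sum_(j <- s) nrm (a i j))%:C%C)
    (\sum_(j <- s) u j)%:C%C.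
  elim: s => [|j s IH].
    rewrite big_nil; move=> e e0; exists fset0 => D _.
    by rewrite big1 ?subrr ?nrm0 // => i _; rewrite big_nil.
  rewrite big_cons rmorphD; apply: eq_sums (sumsD (uP j) IH) => i.
  by rewrite big_cons rmorphD.
have u0 : 0 <= \sum_(j <- A) u j.
  by apply: sumr_ge0 => j _; rewrite (le_trans (nrm_ge0 (t j))).
rewrite -(nrm_real u0); apply: sums_le (us A) => D.
rewrite (le_trans _ (bB D)) // ler_sum // => i _.
by rewrite nrm_real ?ab // sumr_ge0 // => j _; exact: nrm_ge0.
Qed.

(** A normally convergent series of power series may be summed coefficient by coefficient. Products,
    compositions and geometric series need only the norm; termwise differentiation also needs to
    know that the coefficients are the sums of the coefficients. *)
Lemma anac_series (J : choiceType) r B f (F : J -> 'rV[C]_n -> C)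
    (d : J -> mi n -> C) (b : J -> R) : 0 < r ->
  (forall j, anac r (b j) (F j) (d j)) ->
  (forall A : {fset J}, \sum_(j <- A) b j <= B) ->
  (forall x, pdisc r x -> sums (fun j => F j x) (f x)) ->
  exists2 e, anac r B f e & forall K, sums (d^~ K) (e K).
Proof.
move=> r0 dF bB Ff.
have /choice[e eP] : forall K, exists l, sums (d^~ K) l.
  move=> K; apply: (@absb_sums _ _ _ (B / r ^+ deg K)) => A.
  rewrite ler_pdivlMr ?exprn_gt0 // (le_trans _ (bB A)) // mulr_suml.
  rewrite ler_sum // => j _; have [/absb1 h _] := dF j.
  by have := h K; rewrite (nrm_weight _ _ (ltW r0)).
exists e => //; split=> [|x rx].
  have rowB j : absb (fun K => d j K * r%:C%C ^+ deg K) (b j) by case: (dF j).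
  apply: (absb_exchange rowB bB) => K.
  by rewrite mulrC; apply: eq_sums (sumsZ (r%:C%C ^+ deg K) (eP K)) => j; rewrite mulrC.
apply: (@sums_exchange _ _ _ (fun j K => d j K * monom x K) _ _ b B _ _ bB
  _ _ (Ff x rx)).
- by move=> j; have [dB _] := dF j; apply: absb_monom dB (ltW r0) rx.
- by move=> j; have [_] := dF j; apply.
by move=> K; rewrite mulrC; apply: eq_sums (sumsZ _ (eP K)) => j; rewrite mulrC.
Qed.

Lemma ana_series (J : choiceType) r B f (F : J -> 'rV[C]_n -> C) (b : J -> R) :
  0 < r -> (forall j, ana r (b j) (F j)) ->
  (forall A : {fset J}, \sum_(j <- A) b j <= B) ->
  (forall x, pdisc r x -> sums (fun j => F j x) (f x)) -> ana r B f.
Proof.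
move=> r0 /choice[d dF] bB Ff.
by have [e eP _] := anac_series r0 dF bB Ff; exists e.
Qed.

Lemma anaZ r B f c : ana r B f -> ana r (nrm c * B) (fun x => c * f x).
Proof.
move=> [d [dB df]]; exists (fun K => c * d K); split=> [A|x rx].
  rewrite (le_trans _ (ler_wpM2l (nrm_ge0 c) (dB A))) // mulr_sumr ler_sum // => K _.
  by rewrite -mulrA nrmM.
by apply: eq_sums (sumsZ c (df x rx)) => K; rewrite mulrA.
Qed.

(** Only f is expanded: multiplying g by the term of index K of f costs the factor |d_K| r^|K|, and
    these factors add up to at most B. *)
Lemma anaM r B B' f g : 0 < r -> ana r B f -> ana r B' g ->
  ana r (B * B') (fun x => f x * g x).
Proof.
move=> r0 [d [dB df]] gB; have B'0 := ana_ge0 gB.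
apply: (@ana_series _ r _ _ (fun K x => d K * (monom x K * g x))
  (fun K => nrm (d K) * (r ^+ deg K * B')) r0).
- by move=> K; apply/anaZ/ana_mul_monom => //; exact: ltW.
- move=> A; rewrite (le_trans _ (ler_wpM2r B'0 (dB A))) // mulr_suml ler_sum // => K _.
  by rewrite (nrm_weight _ _ (ltW r0)) // mulrA.
- move=> x rx; rewrite mulrC; apply: eq_sums (sumsZ (g x) (df x rx)) => K.
  by rewrite mulrC mulrA.
Qed.

Lemma ana_coord r i : 0 <= r -> ana r r (fun x => x 0 i).
Proof.
move=> r0; have := ana_mulX i r0 (ana_cst r 1); rewrite nrm1 mulr1.
by apply: eq_ana => x _; rewrite mulr1.
Qed.

Lemma anaX r B f k : 0 < r -> ana r B f -> ana r (B ^+ k) (fun x => f x ^+ k).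
Proof.
move=> r0 fB; elim: k => [|k IH]; first by rewrite expr0 -nrm1; exact: ana_cst.
by rewrite exprS; apply: eq_ana (anaM r0 fB IH) => x _; rewrite exprS.
Qed.

Lemma ana_prod (I : Type) (s : seq I) r (B : I -> R) (F : I -> 'rV[C]_n -> C) :
  0 < r -> (forall i, ana r (B i) (F i)) ->
  ana r (\prod_(i <- s) B i) (fun x => \prod_(i <- s) F i x).
Proof.
move=> r0 FB; elim: s => [|i s IH].
  rewrite big_nil -nrm1; apply: eq_ana (ana_cst r 1) => x _.
  by rewrite big_nil.
by rewrite big_cons; apply: eq_ana (anaM r0 (FB i) IH) => x _; rewrite big_cons.
Qed.

Lemma anac0 r B f d : 0 <= r -> anac r B f d -> d (mi0 n) = f 0.
Proof.
move=> r0 [_ df]; have := df 0 (pdisc0 r0).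
have := @sums_single R _ (mi0 n) (fun K => d K * monom (0 : 'rV[C]_n) K).
rewrite monom0 mulr1 => h; apply: sums_uniq; apply: h => K K0.
by rewrite monom0l // mulr0.
Qed.

(** A form of the Schwarz lemma read off the weights: s^|K| <= (s/r)^m r^|K| once |K| >= m. The case
    m = 2 makes the Taylor remainder o(x), and m = 1 makes a function vanishing at the centre
    small. *)
Lemma anac_small r s B f d m : 0 < s -> s <= r -> anac r B f d ->
  (forall K, (deg K < m)%N -> d K = 0) -> anac s (B * (s / r) ^+ m) f d.
Proof.
move=> s0 sr [dB df] d0; have r0 := lt_le_trans s0 sr.
have q0 : 0 <= s / r by rewrite divr_ge0 // ltW.
split=> [A|x sx]; last exact/df/(pdisc_le sr).
rewrite mulrC; apply: le_trans (ler_wpM2l (exprn_ge0 m q0) (dB A)).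
rewrite mulr_sumr; apply: ler_sum => K _; rewrite !nrm_weight ?(ltW s0) ?(ltW r0) //.
case: (ltnP (deg K) m) => [/d0 ->|mK]; first by rewrite nrm0 !mul0r mulr0.
rewrite mulrCA ler_wpM2l ?nrm_ge0 // expr_div_n mulrAC ler_pdivlMr ?exprn_gt0 //.
rewrite -(subnK mK) !exprD -mulrA [leRHS]mulrCA.
rewrite ler_wpM2r ?mulr_ge0 ?exprn_ge0 ?(ltW s0) ?(ltW r0) //.
by rewrite lerXn2r ?nnegrE ?(ltW s0) ?(ltW r0).
Qed.
End Ana.
End PowerSeries.

(** * Complex differentials *)

Section LinearForm.
Variables (R : realType) (n : nat) (w : 'I_n -> R[i]).
Local Notation C := R[i].

Definition linform (v : 'rV[C]_n) : C := \sum_i v 0 i * w i.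

Lemma linform_is_linear : linear (linform : 'rV[C]_n -> C).
Proof.
move=> c u v; rewrite /linform scaler_sumr -big_split /=.
by apply: eq_bigr => i _; rewrite !mxE mulrDl -mulrA.
Qed.

HB.instance Definition _ :=
  GRing.isLinear.Build C 'rV[C]_n C _ linform linform_is_linear.

Lemma linform_continuous : continuous linform.
Proof.
move=> x; rewrite /linform; elim: (index_enum _) => [|i s IH].
  rewrite (_ : (fun v : 'rV[C]_n => _) = cst 0); last first.
    by apply/funext => v; rewrite big_nil.
  exact: cst_continuous.
rewrite (_ : (fun v : 'rV[C]_n => _) =
    (fun v => v 0 i * w i) + (fun v => \sum_(j <- s) v 0 j * w j)); last first.
  by apply/funext => v; rewrite big_cons.
apply: continuousD IH.
exact: (cvgMr_tmp (@coord_continuous C 1 n 0 i x)).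

Qed.

Lemma linform_diff a : differentiable linform a.
Proof. exact: linear_differentiable (@linform_continuous). Qed.

Lemma derive_linform a v : 'D_v linform a = linform v.
Proof.
by rewrite (deriveE _ (linform_diff a)) (diff_lin a (@linform_continuous)).
Qed.

End LinearForm.

Section Calculus.
Variable R : realType.
Local Notation C := R[i].
Local Notation mi n := {ffun 'I_n -> nat}.

(** By submultiplicativity the product of the powers G_i^(K_i) has norm at most rho^|K|, which is
    the weight of the index K in the norm of F at radius rho. *)
Lemma ana_comp n m r rho B (F : 'rV[C]_n -> C) (G : 'I_n -> 'rV[C]_m -> C) :
  0 < r -> 0 <= rho -> ana rho B F -> (forall i, ana r rho (G i)) ->
  ana r B (fun x => F (\row_i G i x)).
Proof.
move=> r0 rho0 [d [dB dF]] Gr.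
have Gx x : pdisc r x -> pdisc rho (\row_i G i x).
  by move=> rx i; rewrite mxE (ana_bound (ltW r0) (Gr i)).
apply: (@ana_series _ _ _ _ _ _ (fun K x => d K * \prod_i G i x ^+ K i)
  (fun K => nrm (d K) * rho ^+ deg K) r0).
- move=> K; apply: anaZ; rewrite /deg -prodrXr.
  by apply: ana_prod => // i; exact: anaX.
- move=> A; rewrite (le_trans _ (dB A)) // ler_sum // => K _.
  by rewrite nrm_weight.
- move=> x rx; apply: eq_sums (dF _ (Gx x rx)) => K.
  by congr (_ * _); apply: eq_bigr => i _; rewrite mxE.
Qed.

(** Recentring is the substitution of a + x, whose coordinates have norm at most r + s at radius s;
    the bound B does not change. *)
Lemma ana_shift n r s B (f : 'rV[C]_n -> C) a : 0 < s -> 0 <= r ->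
  pdisc r a -> ana (r + s) B f -> ana s B (fun x => f (a + x)).
Proof.
move=> s0 r0 ra fB; have rs0 : 0 <= r + s by rewrite addr_ge0 // ltW.
have h i : ana s (r + s) (fun x : 'rV[C]_n => a 0 i + x 0 i).
  have ci := ana_coord i (ltW s0).
  apply: ana_le (anaD (ana_cst n s (a 0 i)) ci) => //; first exact: ltW.
  by rewrite lerD2r.
apply: eq_ana (ana_comp s0 rs0 fB h) => x _; congr f.
by apply/rowP => i; rewrite !mxE.
Qed.

Section Differential.
Import interval_inference landau.
Variable n : nat.
Implicit Types (f : 'rV[C]_n -> C) (a : 'rV[C]_n).

Definition unit_mi (i : 'I_n) : mi n := incr i (mi0 n).

Lemma deg_unit i : deg (unit_mi i) = 1%N.
Proof. by rewrite deg_incr deg_mi0. Qed.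

Lemma unit_mi_inj : injective unit_mi.
Proof.
move=> i j /ffunP/(_ i); rewrite !ffunE eqxx.
by case: eqP.
Qed.

Lemma deg1_unit K : deg K = 1%N -> exists i, K = unit_mi i.
Proof.
elim/mi_ind: K => [|i K _]; first by rewrite deg_mi0.
rewrite deg_incr => -[/eqP]; rewrite deg_eq0 => /eqP ->.
by exists i.
Qed.

Lemma monom_unit (x : 'rV[C]_n) i : monom x (unit_mi i) = x 0 i.
Proof. by rewrite monom_incr monom0 mulr1. Qed.

Lemma sums_sum (I : choiceType) (T : Type) (s : seq T) (a : T -> I -> C) l :
  (forall t, sums (a t) (l t)) ->
  sums (fun i => \sum_(t <- s) a t i) (\sum_(t <- s) l t).
Proof.
move=> al; elim: s => [|t s IH].
  move=> e e0; exists fset0 => B _.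
  by rewrite big_nil big1 ?subrr ?nrm0 // => i _; rewrite big_nil.
by rewrite big_cons; apply: eq_sums (sumsD (al t) IH) => i; rewrite big_cons.
Qed.

Lemma anac_remainder r B f d : 0 <= r -> anac r B f d ->
  anac r B (fun x => f x - f 0 - linform (fun i => d (unit_mi i)) x)
    (fun K => if (deg K < 2)%N then 0 else d K).
Proof.
move=> r0 df; have d0 := anac0 r0 df; case: (df) => dB dx; split=> [|x rx].
  apply: absb_le dB _ => K; case: ifP => // _.
  by rewrite mul0r nrm0 nrm_ge0.
have s0 := @sums_single R _ (mi0 n) (fun K => if K == mi0 n then d K * monom x K else 0).
have {}s0 := s0 (fun K K0 => ifN_eq _ _ K0).
rewrite eqxx monom0 mulr1 d0 in s0.
have s1 : sums (fun K => \sum_i (if K == unit_mi i then d K * monom x K else 0))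
    (linform (fun i => d (unit_mi i)) x).
  apply: sums_sum => i.
  have := @sums_single R _ (unit_mi i)
    (fun K => if K == unit_mi i then d K * monom x K else 0).
  rewrite eqxx monom_unit mulrC; apply => K /negbTE -> //.
have := sumsD (dx x rx) (sumsZ (-1) (sumsD s0 s1)).
rewrite mulN1r opprD addrA; apply: eq_sums => K.
rewrite mulN1r; case: (ltnP (deg K) 2) => [|dK].
  rewrite ltnS leq_eqVlt ltnS leqn0 => /orP[/eqP/deg1_unit[i ->]|].
    rewrite -deg_eq0 deg_unit /= add0r (bigD1 i) //= eqxx big1 ?addr0 ?subrr ?mul0r //.
    by move=> j; rewrite (inj_eq unit_mi_inj) eq_sym => /negbTE ->.
  rewrite deg_eq0 => /eqP ->; rewrite eqxx big1 ?addr0 ?subrr ?mul0r // => i _.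
  by rewrite eq_sym -deg_eq0 deg_unit.
rewrite -deg_eq0 gtn_eqF ?(ltn_trans _ dK) // add0r big1 ?oppr0 ?addr0 // => i _.
by case: eqP => // Ki; rewrite Ki deg_unit in dK.
Qed.

Lemma pdisc_norm (x : 'rV[C]_n) : pdisc (complex.Re `|x|) x.
Proof.
have x0 : `|x| = (complex.Re `|x|)%:C%C.
  by have := normr_ge0 x; case: `|x| => u v; rewrite lecE /= => /andP[/eqP ->].
move=> i; rewrite -lecR -x0 -nrmE [leRHS]/Num.Def.normr /= mx_normE.
rewrite -[leLHS]nngE num_le.
exact: (le_bigmax _ (fun ij : 'I_1 * 'I_n => `|x ij.1 ij.2|%:nng%R) (0, i)).
Qed.

(** The remainder after the terms of degree 0 and 1 is at most B (s/r)^2 on the polydisc of radius s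
    = |x|, so the degree 1 part is the differential. *)
Lemma anac_differential r B f d a : 0 < r ->
  anac r B (fun x => f (a + x)) d ->
  differentiable f a /\
  forall v, 'D_v f a = linform (fun i => d (unit_mi i)) v.
Proof.
move=> r0 df; set L := linform _.
have rem := anac_remainder (ltW r0) df.
have H : f \o shift a = cst (f a) + L +o_ (0 : 'rV[C]_n) id.
  apply/eqaddoP => e /real_pos[-> e0]; set e' := complex.Re e in e0 *.
  have B0 : 0 < B + 1 by case: df => /absb_ge0; lra.
  (* For s < s0 this gives B s^2 / r^2 <= e' s; B + 1 is positive even if B = 0. *)
  pose s0 := Num.min r (e' * r ^+ 2 / (B + 1)).
  have s00 : 0 < s0 by rewrite lt_min r0 divr_gt0 // mulr_gt0 // exprn_gt0.
  have s0c : 0 < s0%:C%C :> C by rewrite ltcE /= eqxx.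
  apply: filterS (nbhs0_lt s0c) => x xs0 /=.
  have x_real : `|x| = (complex.Re `|x|)%:C%C.
    by have := normr_ge0 x; case: `|x| => u v; rewrite lecE /= => /andP[/eqP ->].
  have -> : (f \o shift a - (cst (f a) + L)) x =
      f (a + x) - f (a + 0) - L x.
    by rewrite /= !fctE /= addr0 opprD addrA [x + a]addrC.
  move: xs0; rewrite x_real ltcR nrmE -rmorphM lecR.
  have := pdisc_norm x; set s := complex.Re `|x| => sx ss0.
  have s_ge0 : 0 <= s by rewrite -lecR /s -x_real; exact: normr_ge0.
  have [s_eq0|s_neq0] := eqVneq s 0.
    have -> : x = 0.
      by apply/rowP => i; rewrite mxE; apply/nrm_eq0/eqP; rewrite eq_le nrm_ge0 -s_eq0 sx.
    by rewrite subrr /L raddf0 subr0 nrm0 mulr_ge0 // ltW.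
  have s_gt0 : 0 < s by rewrite lt_def s_neq0.
  move: ss0; rewrite lt_min ltr_pdivlMr // => /andP[/ltW sr se].
  have rem0 K : (deg K < 2)%N -> (if (deg K < 2)%N then 0 else d K) = 0.
    by move=> ->.
  have small := anac_small s_gt0 sr rem rem0.
  have := ana_bound s_ge0 (ex_intro _ _ small) sx => /= h.
  rewrite (le_trans h) // expr_div_n mulrA ler_pdivrMr ?exprn_gt0 //.
  have : s * (s * (B + 1)) <= s * (e' * r ^+ 2) by rewrite ler_wpM2l // ltW.
  have : 0 <= s * s by rewrite mulr_ge0.
  by rewrite expr2; nra.
have Lc : continuous L by exact: linform_continuous.
have dE : 'd f a = L :> ('rV[C]_n -> C) by exact: diff_unique H.
have fd : differentiable f a by apply/diff_locallyP; rewrite dE.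
by split=> // v; rewrite deriveE // dE.
Qed.

End Differential.
End Calculus.

(** * Termwise derivatives and the identity theorem *)

Section Derivatives.
Variables (R : realType) (n : nat).
Local Notation C := R[i].
Local Notation mi := {ffun 'I_n -> nat}.
Implicit Types (f g : 'rV[C]_n -> C) (a : 'rV[C]_n).

Lemma linform_delta (w : 'I_n -> C) i : linform w (delta_mx 0 i) = w i.
Proof.
rewrite /linform (bigD1 i) //= mxE !eqxx mul1r big1 ?addr0 // => j /negbTE ji.
by rewrite mxE ji andbF mul0r.
Qed.

Lemma derive_translate f a x v :
  'D_v (fun y => f (a + y)) x = 'D_v f (a + x).
Proof.
rewrite /derive; set F := (X in X @ _); set G := (X in _ = lim (X @ _)).
by have -> : F = G by apply/funext => h; rewrite /F /G /= addrCA.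
Qed.

Lemma ana_monom r K : 0 <= r -> ana r (r ^+ deg K) (fun x : 'rV[C]_n => monom x K).
Proof.
move=> r0; have := ana_mul_monom K r0 (ana_cst n r (1 : C)).
by rewrite nrm1 mulr1; apply: eq_ana => x _; rewrite mulr1.
Qed.

Lemma derive_coord (x v : 'rV[C]_n) j : 'D_v (fun y : 'rV[C]_n => y 0 j) x = v 0 j.
Proof.
have E w : linform (fun i => (i == j)%:R) w = w 0 j :> C.
  rewrite /linform (bigD1 j) //= eqxx mulr1 big1 ?addr0 // => i /negbTE ->.
  by rewrite mulr0.
by rewrite -(funext E) derive_linform E.
Qed.

Lemma ana_differentiable r B f a : 0 < r -> ana r B (fun x => f (a + x)) ->
  differentiable f a.
Proof. by move=> r0 [d /(anac_differential r0)[]]. Qed.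

Lemma monom_differentiable x K : differentiable (fun y : 'rV[C]_n => monom y K) x.
Proof.
pose r : R := \sum_i nrm (x 0 i).
have r0 : 0 <= r by apply: sumr_ge0 => i _; exact: nrm_ge0.
have rx : pdisc r x.
  by move=> i; rewrite /r (bigD1 i) //= lerDl sumr_ge0 // => j _; exact: nrm_ge0.
apply: (@ana_differentiable 1 ((r + 1) ^+ deg K)) => //.
apply: (@ana_shift R n r 1 _ (fun y => monom y K) x) => //.
by apply: ana_monom; rewrite addr_ge0.
Qed.

Lemma decr_incr_neq (i j : 'I_n) K : i != j -> decr i (incr j K) = incr j (decr i K).
Proof.
move=> /negbTE ij; apply/ffunP => k; rewrite !ffunE.
case: (eqVneq k i) => [->|_]; last by rewrite !subn0.
by rewrite ij !addn0.
Qed.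

Lemma derive_monom i K (x : 'rV[C]_n) :
  'D_(delta_mx 0 i) (fun y : 'rV[C]_n => monom y K) x = (K i)%:R * monom x (decr i K).
Proof.
elim/mi_ind: K => [|j K IH].
  rewrite (_ : (fun y => _) = cst 1) ?derive_cst ?ffunE ?mul0r //.
  by apply/funext => y; rewrite monom0.
rewrite (_ : (fun y => _) = (fun y : 'rV[C]_n => y 0 j) * (fun y => monom y K)); last first.
  by apply/funext => y; rewrite monom_incr.
rewrite deriveM; last 2 first.
- exact/diff_derivable/differentiable_coord.
- exact/diff_derivable/monom_differentiable.
rewrite IH derive_coord mxE ?eqxx /= ffunE.
have [<-|ij] := eqVneq j i; last first.
  rewrite /= scaler0 addr0 addn0 decr_incr_neq 1?eq_sym //.
  by rewrite monom_incr [LHS]mulrCA.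
rewrite ?eqxx incrK addn1 -(addn1 (K j)) natrD mulrDl mul1r.
congr (_ + _); last by rewrite /GRing.scale /= mulr1.
have [->|Kj] := eqVneq (K j) 0%N; first by rewrite !mul0r scaler0.
have -> : monom x K = x 0 j * monom x (decr j K) by rewrite -monom_incr decrK.
by rewrite [LHS]mulrCA.
Qed.

(** Coefficients of the formal partial derivative in the variable i. *)
Definition dseries (i : 'I_n) (d : mi -> C) : mi -> C :=
  fun L => (L i).+1%:R * d (incr i L).

(** Every monomial is recentred at x, and the expansions are summed coefficient by coefficient. The
    coefficient at [unit_mi i] is the derivative of f on one side and the sum of the derivatives of
    the monomials on the other, so differentiating termwise is an exchange of sums. *)
Lemma anac_derive r s B f d i x : 0 <= r -> 0 < s -> pdisc r x ->
  anac (r + s) B f d ->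
  sums (fun L => dseries i d L * monom x L) ('D_(delta_mx 0 i) f x).
Proof.
move=> r0 s0 rx df; have rs0 : 0 < r + s by rewrite ltr_wpDl.
have /choice[e eP] K : exists e, anac s (nrm (d K) * (r + s) ^+ deg K)
    (fun y : 'rV[C]_n => d K * monom (x + y) K) e.
  apply: (@ana_shift _ _ r s _ (fun y => d K * monom y K)) => //.
  exact/anaZ/ana_monom/ltW.
have [|y sy|E EP eE] := @anac_series R n _ s B (fun y => f (x + y)) _ e _ s0 eP.
- move=> A; case: df => dB _; rewrite (le_trans _ (dB A)) // ler_sum // => K _.
  by rewrite nrm_weight // ltW.
- by case: df => _; apply; exact: pdiscD.
have [_ /(_ (delta_mx 0 i))] := anac_differential s0 EP.
rewrite linform_delta => DE.
have {}eE := eE (unit_mi i); rewrite -DE in eE.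
pose a K := d K * ((K i)%:R * monom x (decr i K)).
have aE : sums a ('D_(delta_mx 0 i) f x).
  apply: eq_sums eE => K.
  have [_ /(_ (delta_mx 0 i))] := @anac_differential R n s _
    (fun y => d K * monom y K) _ x s0 (eP K).
  rewrite linform_delta => <-; rewrite /a -derive_monom.
  have mK : derivable (fun y : 'rV[C]_n => monom y K) x (delta_mx 0 i).
    exact/diff_derivable/monom_differentiable.
  exact: (deriveZ (d K) mK).
have a0 K : odecr i K = None -> a K = 0.
  by move/odecr_None => Ki; rewrite /a Ki mul0r mulr0.
apply: eq_sums (sums_pull (incr_pcan i) (@odecrK n i) a0 aE) => L /=.
by rewrite /a incrK ffunE eqxx addn1 mulrA /dseries (mulrC (d _)).
Qed.

(** At the corner (r, ..., r) the monomials are the weights r^|K|, so the convergence of the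
    differentiated series there, being absolute, bounds its weighted norm. *)
Lemma anac_dseries r s B f d i : 0 <= r -> 0 < s -> anac (r + s) B f d ->
  exists B', anac r B' ('D_(delta_mx 0 i) f) (dseries i d).
Proof.
move=> r0 s0 df.
have rr : pdisc r (const_mx r%:C%C : 'rV[C]_n).
  by move=> j; rewrite mxE nrm_real.
have [B' hB'] := sums_absb (anac_derive i r0 s0 rr df).
exists B'; split=> [|x rx]; last exact: (anac_derive i r0 s0 rx df).
by move=> A; rewrite (le_trans _ (hB' A)) // ler_sum // => K _; rewrite monom_real.
Qed.

(** Taylor coefficients vanish by induction on the multi-index, each step passing to a derivative.
    Using a class [P] stable under derivatives avoids naming iterated derivatives; it is
    instantiated by functions vanishing near 0, by functions of one variable with zero derivative,
    and by the relations satisfied by d omega. *)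
Lemma anac_flat (P : ('rV[C]_n -> C) -> Prop) a :
  (forall f, P f -> f a = 0) ->
  (forall f i, P f -> P ('D_(delta_mx 0 i) f)) ->
  forall f r B d, P f -> 0 < r -> anac r B (fun x => f (a + x)) d ->
  forall K, d K = 0.
Proof.
move=> P0 PD f r B d Pf r0 df K; move: f r B d Pf r0 df.
move: K; apply: mi_ind => [|i K IH] f r B d Pf r0 df.
  by rewrite (anac0 (ltW r0) df) addr0 P0.
have r20 : 0 < r / 2 by rewrite divr_gt0.
have [|B' dB'] := @anac_dseries (r / 2) (r / 2) B (fun x => f (a + x)) d i (ltW r20) r20.
  by rewrite -splitr.
have {}dB' : anac (r / 2) B' (fun x => 'D_(delta_mx 0 i) f (a + x)) (dseries i d).
  by apply: eq_anac dB' => x _; rewrite derive_translate.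
have /eqP := IH _ _ _ _ (PD f i Pf) r20 dB'.
by rewrite mulf_eq0 pnatr_eq0 /= => /eqP.
Qed.

Lemma anac_eq0 r B f d : (forall K, d K = 0) -> anac r B f d ->
  forall x, pdisc r x -> f x = 0.
Proof.
move=> d0 [_ df] x /df fx; apply: sums_uniq fx _.
by move=> e e0; exists fset0 => A _; rewrite big1 ?subrr ?nrm0 // => K _; rewrite d0 mul0r.
Qed.

Lemma anac_coef0 r B f d : 0 < r -> anac r B f d ->
  (\forall x \near (0 : 'rV[C]_n), f x = 0) -> forall K, d K = 0.
Proof.
move=> r0 df f0.
apply: (@anac_flat (fun g => \forall x \near (0 : 'rV[C]_n), g x = 0) 0 _ _ f r B)
  => //.
- by move=> g /nbhs_singleton.
- move=> g i /near_join; apply: filterS => x gx.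
  by rewrite (near_eq_derive _ (g := cst 0) gx) derive_cst.
by apply: eq_anac df => x _; rewrite add0r.
Qed.

Lemma ana_eq0 r B f : 0 < r -> ana r B f ->
  (\forall x \near (0 : 'rV[C]_n), f x = 0) -> forall x, pdisc r x -> f x = 0.
Proof.
by move=> r0 [d df] f0; apply: (anac_eq0 _ df); exact: anac_coef0 r0 df f0.
Qed.

(** The expansion at q converges at radius r - s > s, so its polydisc contains a neighbourhood of 0;
    the vanishing passes from q to 0 and then, by the expansion at 0, to the whole polydisc. The
    margin s + s < r replaces a connectedness argument. *)
Lemma ana_identity r s B f q : 0 < s -> s + s < r -> ana r B f -> pdisc s q ->
  (\forall x \near q, f x = 0) -> forall x, pdisc r x -> f x = 0.
Proof.
move=> s0 ssr fB sq; rewrite near_shift0 => f0.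
have rs0 : 0 < r - s by lra.
have h : ana (r - s) B (fun x => f (q + x)).
  by apply: (@ana_shift _ _ s) => //; [exact: ltW|rewrite addrC subrK].
have {}h := ana_eq0 rs0 h f0.
apply: (ana_eq0 _ fB); first lra.
apply/nearP; exists (r - s - s); first lra.
move=> x rx; rewrite add0r -(subrK q x) addrC; apply: h.
rewrite -(subrK s (r - s)); apply: pdiscD rx _; exact/pdiscN.
Qed.

End Derivatives.

(** * The ring of holomorphic germs, its derivations and composition *)

Section Holomorphic.
Variable R : realType.
Local Notation C := R[i].

(** Evaluation at the corner of a polydisc again: unconditional convergence there is finiteness of
    the weighted norm. *)
Lemma pseries_anac n (f : 'rV[C]_n -> C) a c : has_pseries f a c ->
  exists r B, 0 < r /\ anac r B (fun x => f (a + x)) c.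
Proof.
move=> /nearP[r r0 rP].
have rr : pdisc r (const_mx r%:C%C : 'rV[C]_n).
  by move=> j; rewrite mxE nrm_real // ltW.
have hs x : pdisc r x -> sums (fun K => c K * monom x K) (f (a + x)).
  by move=> rx; apply/sumsP; have := rP x rx; rewrite add0r.
have [B hB] := sums_absb (hs _ rr); exists r, B; split=> //.
split=> [A|x rx]; last exact: hs.
by rewrite (le_trans _ (hB A)) // ler_sum // => K _; rewrite monom_real.
Qed.

Lemma holoP n (f : 'rV[C]_n -> C) a : holomorphic_at f a <->
  exists r B, 0 < r /\ ana r B (fun x => f (a + x)).
Proof.
split=> [[c /pseries_anac[r [B [r0 fB]]]]|[r [B [r0 [d [dB df]]]]]].
  by exists r, B; split=> //; exists c.
exists d; apply/nearP; exists r => // x rx; rewrite add0r.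
exact/sumsP/df.
Qed.

Lemma holo_radius n (f : 'rV[C]_n -> C) a : holomorphic_at f a ->
  exists r0 B, 0 < r0 /\
    forall r, 0 < r -> r <= r0 -> ana r B (fun x => f (a + x)).
Proof.
move=> /holoP[r0 [B [r00 fB]]]; exists r0, B; split=> // r r_0 rr0.
exact: ana_le (ltW r_0) rr0 (lexx B) fB.
Qed.

Section Closure.
Variable n : nat.
Implicit Types (f g : 'rV[C]_n -> C) (a : 'rV[C]_n).

Lemma holo_cst a c : holomorphic_at (fun=> c : C) a.
Proof. by apply/holoP; exists 1, (nrm c); split=> //; exact: ana_cst. Qed.

Lemma holoD f g a : holomorphic_at f a -> holomorphic_at g a ->
  holomorphic_at (fun x => f x + g x) a.
Proof.
move=> /holo_radius[r [B [r0 fB]]] /holo_radius[s [D [s0 gD]]]; apply/holoP.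
have t0 : 0 < Num.min r s by rewrite lt_min r0.
exists (Num.min r s), (B + D); split=> //; apply: anaD.
  by apply: fB => //; rewrite ge_min lexx.
by apply: gD => //; rewrite ge_min lexx orbT.
Qed.

Lemma holoM f g a : holomorphic_at f a -> holomorphic_at g a ->
  holomorphic_at (fun x => f x * g x) a.
Proof.
move=> /holo_radius[r [B [r0 fB]]] /holo_radius[s [D [s0 gD]]]; apply/holoP.
have t0 : 0 < Num.min r s by rewrite lt_min r0.
exists (Num.min r s), (B * D); split=> //; apply: anaM => //.
  by apply: fB => //; rewrite ge_min lexx.
by apply: gD => //; rewrite ge_min lexx orbT.
Qed.

Lemma holoN f a : holomorphic_at f a -> holomorphic_at (fun x => - f x) a.
Proof.
move=> fh; have := holoM (holo_cst a (-1)) fh.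
by rewrite (_ : (fun x => -1 * f x) = fun x => - f x) //; apply/funext => x;
  rewrite mulN1r.
Qed.

Lemma holoB f g a : holomorphic_at f a -> holomorphic_at g a ->
  holomorphic_at (fun x => f x - g x) a.
Proof. by move=> fh gh; exact/holoD/holoN. Qed.

Lemma holo_sum (I : Type) (s : seq I) (F : I -> 'rV[C]_n -> C) a :
  (forall i, holomorphic_at (F i) a) ->
  holomorphic_at (fun x => \sum_(i <- s) F i x) a.
Proof.
move=> Fh; elim: s => [|i s IH].
  rewrite (_ : (fun _ => _) = fun=> 0); first exact: holo_cst.
  by apply/funext => x; rewrite big_nil.
rewrite (_ : (fun _ => _) = fun x => F i x + \sum_(j <- s) F j x).
  exact: (holoD (Fh i) IH).
by apply/funext => x; rewrite big_cons.
Qed.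

Lemma holo_coord a i : holomorphic_at (fun x : 'rV[C]_n => x 0 i) a.
Proof.
apply/holoP; exists 1, (nrm (a 0 i) + 1); split=> //.
have := anaD (ana_cst n 1 (a 0 i)) (ana_coord i (@ler01 R)).
by apply: eq_ana => x _; rewrite mxE.
Qed.

Lemma near_eq_holo f g a : (\forall x \near a, f x = g x) ->
  holomorphic_at f a -> holomorphic_at g a.
Proof.
rewrite near_shift0 => fg [c fc]; exists c.
by apply: filterS2 fg fc => x ->.
Qed.

Lemma holo_near f a : holomorphic_at f a -> \forall y \near a, holomorphic_at f y.
Proof.
move=> /holoP[r [B [r0 fB]]]; apply/nearP; exists (r / 2); first by rewrite divr_gt0.
move=> x rx; apply/holoP; exists (r / 2), B; split; first by rewrite divr_gt0.
have r20 : 0 < r / 2 by rewrite divr_gt0.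
have := @ana_shift R n (r / 2) (r / 2) B (fun x => f (a + x)) x r20 (ltW r20) rx.
rewrite -splitr => /(_ fB); apply: eq_ana => y _.
by rewrite addrA.
Qed.

Lemma holo_differentiable f a : holomorphic_at f a -> differentiable f a.
Proof. by move=> /holoP[r [B [r0]]]; exact: ana_differentiable. Qed.

Lemma holo_derivable f a v : holomorphic_at f a -> derivable f a v.
Proof. by move=> /holo_differentiable/diff_derivable. Qed.

Lemma holo_continuous f a : holomorphic_at f a -> {for a, continuous f}.
Proof. by move=> /holo_differentiable/differentiable_continuous. Qed.

Lemma derive_sum_coord f a v : holomorphic_at f a ->
  'D_v f a = \sum_i v 0 i * 'D_(delta_mx 0 i) f a.
Proof.
move=> /holoP[r [B [r0 [d df]]]]; have [_ DE] := anac_differential r0 df.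
by rewrite DE; apply: eq_bigr => i _; rewrite DE linform_delta.
Qed.

Lemma holo_derive f a i : holomorphic_at f a ->
  holomorphic_at ('D_(delta_mx 0 i) f) a.
Proof.
move=> /holoP[r [B [r0 [d df]]]].
have r20 : 0 < r / 2 by rewrite divr_gt0.
have [|B' dB'] := @anac_dseries R n (r / 2) (r / 2) B (fun x => f (a + x)) d i (ltW r20) r20.
  by rewrite -splitr.
apply/holoP; exists (r / 2), B'; split=> //; exists (dseries i d).
by apply: eq_anac dB' => x _; rewrite derive_translate.
Qed.

Lemma dseriesC i j (d : {ffun 'I_n -> nat} -> C) :
  dseries i (dseries j d) = dseries j (dseries i d).
Proof.
apply/funext => K; rewrite /dseries.
have -> : incr i (incr j K) = incr j (incr i K).
  by apply/ffunP => k; rewrite !ffunE addnAC.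
have [->//|ij] := eqVneq i j.
by rewrite !ffunE (negbTE ij) eq_sym (negbTE ij) !addn0 mulrCA.
Qed.

(** The formal derivatives commute, so both sides are the constant term of the same series. *)
Lemma deriveC f a i j : holomorphic_at f a ->
  'D_(delta_mx 0 i) ('D_(delta_mx 0 j) f) a =
  'D_(delta_mx 0 j) ('D_(delta_mx 0 i) f) a.
Proof.
move=> /holoP[r [B [r0 [d df]]]].
(* Each of the two differentiations costs a third of the radius, and a third remains. *)
have r30 : 0 < r / 3 by rewrite divr_gt0.
have second k l : exists B', anac (r / 3) B'
    (fun x => 'D_(delta_mx 0 k) ('D_(delta_mx 0 l) f) (a + x))
    (dseries k (dseries l d)).
  have [||B1 h1] := @anac_dseries R n (r / 3 + r / 3) (r / 3) B (fun x => f (a + x)) d l _ r30.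
  - by rewrite addr_ge0 // ltW.
  - by move: df; congr (anac _ _ _ _); field.
  have {}h1 : anac (r / 3 + r / 3) B1 (fun x => 'D_(delta_mx 0 l) f (a + x))
      (dseries l d).
    by apply: eq_anac h1 => x _; exact: derive_translate.
  have [B2 h2] := anac_dseries k (ltW r30) r30 h1.
  exists B2; apply: eq_anac h2 => x _.
  exact: (derive_translate ('D_(delta_mx 0 l) f)).
have [B1 h1] := second i j; have [B2 h2] := second j i.
rewrite dseriesC in h1.
have := anac0 (ltW r30) h1; have := anac0 (ltW r30) h2.
by rewrite addr0 => E2 E1; exact: etrans (esym E1) E2.
Qed.

Lemma holo_flat (P : ('rV[C]_n -> C) -> Prop) a :
  (forall f, P f -> f a = 0) ->
  (forall f i, P f -> P ('D_(delta_mx 0 i) f)) ->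
  forall f, P f -> holomorphic_at f a -> \forall x \near a, f x = 0.
Proof.
move=> P0 PD f Pf /holoP[r [B [r0 [d df]]]].
apply/nearP; exists r => //; apply: (anac_eq0 _ df).
exact: (anac_flat P0 PD Pf r0 df).
Qed.

(** Germs form an integral domain: if f is not zero near a, there are points arbitrarily close to a
    where f does not vanish; g vanishes around such a point, hence around a by the identity theorem.
    This allows cancelling a function that vanishes at a. *)
Lemma holo_mul_eq0 f g a : holomorphic_at f a -> holomorphic_at g a ->
  (\forall x \near a, f x * g x = 0) ->
  ~ (\forall x \near a, f x = 0) -> \forall x \near a, g x = 0.
Proof.
move=> fh /[dup] gh /holoP[r [B [r0 gB]]] fg nf.
have : \forall x \near a, holomorphic_at f x /\ \forall y \near x, f y * g y = 0.
  by apply: filterS2 (holo_near fh) (near_join fg) => x.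
move=> /nearP[s s0 hs].
pose t := Num.min s (r / 3); have t0 : 0 < t by rewrite lt_min s0 divr_gt0.
apply: contrapT => ng; apply: nf; apply/nearP; exists t => // q tq.
apply/eqP/negPn/negP => fq; apply: ng.
have [fc fgq] : holomorphic_at f (a + q) /\ \forall y \near (a + q), f y * g y = 0.
  by apply: hs; apply: pdisc_le tq; rewrite ge_min lexx.
have g0 : \forall y \near q, g (a + y) = 0.
  have fn0 : \forall y \near (a + q), f y != 0.
    exact: (cvgr_neq0 _ (holo_continuous fc) fq).
  have : \forall y \near (a + q), g y = 0.
    apply: filterS2 fn0 fgq => y fy0 /eqP.
    by rewrite mulf_eq0 (negbTE fy0) => /eqP.
  by rewrite near_shift0 (near_shift0 q); apply: filterS => y; rewrite addrA.
have tr : t <= r / 3 by rewrite ge_min lexx orbT.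
by apply/nearP; exists r => //; apply: (ana_identity t0 _ gB tq g0); lra.
Qed.

End Closure.

Lemma ana_small0 n r s B (f : 'rV[C]_n -> C) : 0 < s -> s <= r -> ana r B f ->
  f 0 = 0 -> ana s (B * (s / r)) f.
Proof.
move=> s0 sr [d df] f0; exists d; rewrite -[s / r]expr1.
apply: (anac_small s0 sr df) => K; rewrite ltnS leqn0 deg_eq0 => /eqP ->.
by rewrite (anac0 _ df) // (le_trans (ltW s0)).
Qed.

(** Smallness in the l1 norm, not only in value: this is what [ana_comp] asks of the inner functions
    and what the geometric series asks of its ratio. *)
Lemma holo_small n (f : 'rV[C]_n -> C) a e : holomorphic_at f a -> f a = 0 ->
  0 < e -> exists r0, 0 < r0 /\
    forall r, 0 < r -> r <= r0 -> ana r e (fun x => f (a + x)).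
Proof.
move=> /holoP[r [B [r0 fB]]] fa e0; have B0 := ana_ge0 fB.
have B10 : 0 < B + 1 by lra.
exists (Num.min r (e * r / (B + 1))); split.
  by rewrite lt_min r0 divr_gt0 // mulr_gt0.
move=> s s0; rewrite le_min => /andP[sr]; rewrite ler_pdivlMr // => se.
have := ana_small0 s0 sr fB; rewrite addr0 => /(_ fa).
apply: ana_le (ltW s0) (lexx s) _.
by rewrite mulrA ler_pdivrMr //; nra.
Qed.

Lemma min_radius (I : finType) (P : I -> R -> Prop) :
  (forall i, exists r0, 0 < r0 /\ forall r, 0 < r -> r <= r0 -> P i r) ->
  exists r0, 0 < r0 /\ forall r, 0 < r -> r <= r0 -> forall i, P i r.
Proof.
move=> /choice[r0 r0P]; pose m := \big[Num.min/1]_i r0 i.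
exists m; split; first by rewrite /m; apply: lt_bigmin => // i _; case: (r0P i).
move=> r r_0 rm i; apply: (r0P i).2 => //; rewrite (le_trans rm) //.
exact: bigmin_le_cond.
Qed.

Lemma holo_comp n m (F : 'rV[C]_n -> C) (G : 'rV[C]_m -> 'rV[C]_n) a :
  holomorphic_at F (G a) -> (forall i, holomorphic_at (fun x => G x 0 i) a) ->
  holomorphic_at (fun x => F (G x)) a.
Proof.
move=> /holoP[r [B [r0 FB]]] Gh.
have [i|s [s0 sP]] := @min_radius 'I_n
    (fun i s => ana s r (fun x => G (a + x) 0 i - G a 0 i)).
  apply: (@holo_small _ (fun x => G x 0 i - G a 0 i)) => //.
    exact/holoB/holo_cst.
  by rewrite subrr.
apply/holoP; exists s, B; split=> //.
apply: eq_ana (ana_comp s0 (ltW r0) FB (sP s s0 (lexx s))) => x _.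
by congr F; apply/rowP => i; rewrite !mxE addrC subrK.
Qed.

End Holomorphic.

(** * Inverses and the chain rule *)

Section Inverse.
Variable R : realType.
Local Notation C := R[i].

Lemma geometric_bound (A : {fset nat}) : \sum_(j <- A) (1 / 2 : R) ^+ j <= 2.
Proof.
have h N : forall B : {fset nat}, (forall j, j \in B -> (j < N)%N) ->
    \sum_(j <- B) (1 / 2 : R) ^+ j <= 2 - 2 * (1 / 2) ^+ N.
  elim: N => [|N IH] B BN.
    have -> : B = fset0 by apply/fsetP => j; apply/negbTE/negP => /BN.
    by rewrite big_seq_fset0 expr0 mulr1 subrr.
  have p0 : 0 <= (1 / 2 : R) ^+ N by rewrite exprn_ge0 // divr_ge0.
  rewrite exprS.
  case: (boolP (N \in B)) => NB.
    rewrite (big_fsetD1 N) //=.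
    have /IH : forall j, j \in (B `\ N)%fset -> (j < N)%N.
      move=> j; rewrite !inE => /andP[jN /BN].
      by rewrite ltnS leq_eqVlt (negbTE jN).
    by move: p0; set p := _ ^+ N; set S := \sum_(j <- _) _; lra.
  have /IH : forall j, j \in B -> (j < N)%N.
    move=> j jB; have := BN _ jB; rewrite ltnS leq_eqVlt => /orP[/eqP jN|//].
    by rewrite jN (negbTE NB) in jB.
  by move: p0; set p := _ ^+ N; set S := \sum_(j <- _) _; lra.
apply: le_trans (h (\max_(i <- A) i).+1 A _) _ => [j jA|].
  by rewrite ltnS; apply: (leq_bigmax_seq (F := id)).
by rewrite gerBl mulr_ge0 // exprn_ge0 // divr_ge0.
Qed.

(** The sums run over arbitrary finite sets of exponents, so instead of a closed formula for partial
    sums the proof shows that the sum l, which exists by domination, satisfies l = 1 + z l. *)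
Lemma sums_geometric (z : C) : nrm z <= 1 / 2 ->
  sums (fun j : nat => z ^+ j) (1 - z)^-1.
Proof.
move=> z2; have [|l hl] := @absb_sums R _ (fun j : nat => z ^+ j) 2.
  move=> A; rewrite (le_trans _ (geometric_bound A)) // ler_sum // => j _.
  by rewrite nrmX lerXn2r ?nnegrE ?nrm_ge0 // divr_ge0.
pose p (j : nat) := if j is k.+1 then Some k else None.
have pK : pcancel S p by [].
have pS : ocancel p S by case.
pose b (j : nat) := if j is k.+1 then z * z ^+ k else 0.
have b0 j : p j = None -> b j = 0 by case: j.
have hb : sums b (z * l) by apply: (sums_push pK pS b0); exact: sumsZ.
pose c (j : nat) : C := if j == 0%N then 1 else 0.
have hc : sums c 1.
  by apply: (@sums_single R _ 0%N c) => j /negbTE; rewrite /c => ->.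
have E : l = 1 + z * l.
  apply: sums_uniq hl _; apply: eq_sums (sumsD hc hb) => -[|j].
    by rewrite /c /b addr0 expr0.
  by rewrite /c /b /= add0r exprS.
have zn : 1 - z != 0.
  rewrite subr_eq0; apply/eqP => z1; rewrite -z1 nrm1 in z2.
  by move: z2; lra.
suff <- : l = (1 - z)^-1 by [].
by apply: (mulfI zn); rewrite mulfV // mulrBl mul1r {1}E addrK.
Qed.

(** Write f = f(a) (1 - u) with u(a) = 0; on a small polydisc u has norm at most 1/2, and the
    geometric series in u converges in norm. *)
Lemma holoV n (f : 'rV[C]_n -> C) a : holomorphic_at f a -> f a != 0 ->
  holomorphic_at (fun x => (f x)^-1) a.
Proof.
move=> fh fa0.
have uh : holomorphic_at (fun x => 1 - (f a)^-1 * f x) a.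
  by apply: holoB; [exact: holo_cst|apply: holoM fh; exact: holo_cst].
have [||r0 [r00 rP]] := @holo_small R n _ a (1 / 2) uh.
- by rewrite mulVf // subrr.
- by rewrite divr_gt0.
have {}uB := rP r0 r00 (lexx _).
apply/holoP; exists r0, (nrm (f a)^-1 * 2); split=> //.
apply: (@eq_ana _ _ _ _ (fun x => (f a)^-1 * (1 - (1 - (f a)^-1 * f (a + x)))^-1)).
  move=> x _; rewrite opprB addrCA subrr addr0 invfM invrK mulrA mulVf //.
  by rewrite mul1r.
apply: anaZ.
apply: (@ana_series R n nat r0 2 _ (fun j x => (1 - (f a)^-1 * f (a + x)) ^+ j)
  (fun j => (1 / 2) ^+ j)) => //.
- by move=> j; exact: anaX.
- exact: geometric_bound.
- by move=> x rx; apply: sums_geometric; exact: (ana_bound (ltW r00) uB).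
Qed.

End Inverse.

(** * Rules for directional derivatives, and constancy along lines *)

Section DerivativeRules.
Variable R : realType.
Local Notation C := R[i].

Section Rules.
Variable n : nat.
Implicit Types (f g : 'rV[C]_n -> C) (a v : 'rV[C]_n).

Lemma derive_add f g a v : holomorphic_at f a -> holomorphic_at g a ->
  'D_v (fun x => f x + g x) a = 'D_v f a + 'D_v g a.
Proof. by move=> fh gh; apply: deriveD; exact: holo_derivable. Qed.

Lemma derive_mul f g a v : holomorphic_at f a -> holomorphic_at g a ->
  'D_v (fun x => f x * g x) a = 'D_v f a * g a + f a * 'D_v g a.
Proof.
move=> fh gh.
have := @deriveM _ _ f g a v (holo_derivable fh) (holo_derivable gh).
by rewrite addrC [X in _ = X + _ -> _]mulrC.
Qed.

Lemma derive_sumh (I : Type) (s : seq I) (F : I -> 'rV[C]_n -> C) a v :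
  (forall i, holomorphic_at (F i) a) ->
  'D_v (fun x => \sum_(i <- s) F i x) a = \sum_(i <- s) 'D_v (F i) a.
Proof.
move=> Fh; elim: s => [|i s IH].
  rewrite big_nil (_ : (fun _ => _) = cst 0) ?derive_cst //.
  by apply/funext => x; rewrite big_nil.
rewrite (_ : (fun _ => _) = fun x => F i x + \sum_(j <- s) F j x); last first.
  by apply/funext => x; rewrite big_cons.
by rewrite big_cons -IH; exact: (derive_add v (Fh i) (holo_sum s Fh)).
Qed.

Lemma near_derive0 f a v : (\forall x \near a, f x = 0) -> 'D_v f a = 0.
Proof. by move=> f0; rewrite (near_eq_derive _ (g := cst 0) f0) derive_cst. Qed.

Lemma derive_dirD f a u v : holomorphic_at f a ->
  'D_(u + v) f a = 'D_u f a + 'D_v f a.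
Proof. by move=> /holo_differentiable fd; rewrite !deriveE // linearD. Qed.

End Rules.

Lemma row_differentiable n m (G : 'rV[C]_n -> 'rV[C]_m) a :
  (forall j, holomorphic_at (fun x => G x 0 j) a) -> differentiable G a.
Proof.
move=> Gh; rewrite (_ : G = \sum_j (fun x => G x 0 j *: delta_mx 0 j)).
  by apply: differentiable_sum => j; apply/differentiableZl/holo_differentiable.
by apply/funext => x; rewrite fct_sumE; exact: row_sum_delta.
Qed.

Lemma derive_comp n m (F : 'rV[C]_m -> C) (G : 'rV[C]_n -> 'rV[C]_m) a v :
  holomorphic_at F (G a) -> (forall j, holomorphic_at (fun x => G x 0 j) a) ->
  'D_v (fun x => F (G x)) a = 'D_(\row_j 'D_v (fun x => G x 0 j) a) F (G a).
Proof.
move=> /holo_differentiable Fd Gh; have Gd := row_differentiable Gh.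
rewrite (deriveE _ (differentiable_comp Gd Fd)) diff_comp // (deriveE _ Fd) /=.
congr ('d F (G a) _); apply/rowP => j; rewrite mxE.
have cd := @differentiable_coord C 1 m (G a) 0 j.
rewrite (deriveE _ (differentiable_comp Gd cd)) [RHS](congr1 (@^~ v) (diff_comp Gd cd)).
exact: (etrans (esym (derive_coord (G a) ('d G a v) j)) (deriveE _ cd)).
Qed.

Lemma derive_lsubmx n m (c : 'rV[C]_n -> C) y v :
  'D_v (fun y : 'rV[C]_(n + m) => c (lsubmx y)) y = 'D_(lsubmx v) c (lsubmx y).
Proof.
rewrite /derive; set F := (X in X @ _); set G := (X in _ = lim (X @ _)).
by have -> : F = G by apply/funext => h; rewrite /F /G /= linearP.
Qed.

Lemma derive_line n (f : 'rV[C]_n -> C) p v (t : 'rV[C]_1) :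
  'D_(delta_mx 0 0) (fun t : 'rV[C]_1 => f (p + t 0 0 *: v)) t = 'D_v f (p + t 0 0 *: v).
Proof.
rewrite /derive; set F := (X in X @ _); set G := (X in _ = lim (X @ _)).
have -> // : F = G.
by apply/funext => h; rewrite /F /G /= !mxE eqxx mulr1 scalerDl addrCA.
Qed.

Lemma ana_holo n r s B (f : 'rV[C]_n -> C) q : ana r B f -> pdisc s q ->
  0 < s -> s < r -> holomorphic_at f q.
Proof.
move=> fB sq s0 sr; apply/holoP; exists (r - s), B; split; first by rewrite subr_gt0.
apply: (@ana_shift _ _ s) => //; first by rewrite subr_gt0.
  exact: ltW.
by rewrite addrC subrK.
Qed.

Lemma holo_neq0_near n (f : 'rV[C]_n -> C) : holomorphic_at f 0 ->
  ~ (\forall x \near (0 : 'rV[C]_n), f x = 0) ->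
  \forall y \near (0 : 'rV[C]_n), ~ (\forall x \near y, f x = 0).
Proof.
move=> /holoP[r [B [r0 fB]]] fn; have r30 : 0 < r / 3 by rewrite divr_gt0.
apply/nearP; exists (r / 3); first exact: r30.
move=> y ry fy; apply: fn.
rewrite add0r in fy.
apply/nearP; exists r; first exact: r0.
move=> x rx; rewrite add0r.
have {}fB : ana r B f by apply: eq_ana fB => z _; rewrite add0r.
have lt_r : r / 3 + r / 3 < r by lra.
exact: (ana_identity r30 lt_r fB ry fy).
Qed.

Lemma holo_row_near n m (G : 'rV[C]_n -> 'rV[C]_m) a r :
  (forall j, holomorphic_at (fun x => G x 0 j) a) -> 0 < r ->
  \forall x \near a, pdisc r (G x - G a).
Proof.
move=> Gh r0.
have [j|s [s0 sP]] := @min_radius R 'I_m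
    (fun j s => ana s r (fun x => G (a + x) 0 j - G a 0 j)).
  apply: (@holo_small _ _ (fun x => G x 0 j - G a 0 j)) => //.
    exact/holoB/holo_cst.
  by rewrite subrr.
apply/nearP; exists s => // x sx j; rewrite !mxE.
exact: (ana_bound (ltW s0) (sP s s0 (lexx s) j) sx).
Qed.

(** On the complex line through p + q along v, k is a power series in one variable t converging for
    |t| <= 2, with derivative zero near t = 0; hence it has equal values at t = 0 and t = 1. The
    radius found is uniform in q and v. *)
Lemma line_const n (k : 'rV[C]_n -> C) p (S : set 'rV[C]_n) :
  holomorphic_at k p ->
  (\forall y \near p, forall v, S v -> 'D_v k y = 0) ->
  exists2 r, 0 < r & forall q v, pdisc r q -> pdisc r v -> S v ->
    k (p + q + v) = k (p + q).
Proof.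
move=> /holoP[R0 [B [R00 kB]]] /nearP[d d0 dk].
(* The point q + t v stays within R0 for |t| <= 2 and within d for |t| <= 1. *)
pose r := Num.min (R0 / 3) (d / 2).
have r0 : 0 < r by rewrite lt_min !divr_gt0.
have rR : r <= R0 / 3 by rewrite ge_min lexx.
have rd : r <= d / 2 by rewrite ge_min lexx orbT.
exists r => // q v rq rv Sv.
pose phi (t : 'rV[C]_1) := k (p + q + t 0 0 *: v).
have r20 : 0 < 2 :> R by [].
have phiB : ana 2 B phi.
  have h i : ana 2 R0 (fun t : 'rV[C]_1 => q 0 i + v 0 i * t 0 0).
    apply: ana_le (anaD (ana_cst 1 2 (q 0 i)) (anaZ (v 0 i) (ana_coord 0 (ltW r20)))) => //.
    by have := rq i; have := rv i; lra.
  apply: eq_ana (ana_comp r20 (ltW R00) kB h) => t _; rewrite /phi -addrA.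
  by congr (k (_ + _)); apply/rowP => i; rewrite !mxE mulrC.
have Dphi : \forall t \near (0 : 'rV[C]_1), 'D_(delta_mx 0 0) phi t = 0.
  apply/nearP; exists 1 => // t t1; rewrite add0r derive_line -addrA; apply: dk => //.
  apply: (@pdisc_le _ _ (r + r)); first lra.
  apply: pdiscD => // i; rewrite mxE nrmM -[leRHS]mul1r.
  by rewrite ler_pM ?nrm_ge0.
pose f t := phi t + - phi 0.
have fB : ana 2 (B + nrm (- phi 0)) f by apply: anaD phiB (ana_cst _ _ _).
have [e fe] := fB.
have phih : \forall t \near (0 : 'rV[C]_1), holomorphic_at phi t.
  apply/nearP; exists 1 => // t t1; rewrite add0r.
  by apply: (ana_holo phiB t1) => //; lra.
pose P (g : 'rV[C]_1 -> C) := g 0 = 0 /\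
  \forall t \near (0 : 'rV[C]_1), 'D_(delta_mx 0 0) g t = 0.
have P0 g : P g -> g 0 = 0 by case.
have PD g i : P g -> P ('D_(delta_mx 0 i) g).
  rewrite (ord1 i) => -[_ Dg]; split; first exact: (nbhs_singleton Dg).
  apply: filterS (near_join Dg) => t Dt.
  exact: (near_derive0 (f := 'D_(delta_mx 0 0) g)).
have Pf : P f.
  split; first by rewrite /f subrr.
  apply: filterS2 Dphi phih => t Dt th.
  rewrite /f (derive_add _ th (holo_cst _ _)) Dt add0r.
  exact: derive_cst.
have fe0 : anac 2 (B + nrm (- phi 0)) (fun t => f (0 + t)) e.
  by apply: eq_anac fe => t _; rewrite add0r.
have e0 := anac_flat P0 PD Pf r20 fe0.
have h1 : pdisc 2 (const_mx 1 : 'rV[C]_1).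
  by move=> i; rewrite mxE nrm1; lra.
have := anac_eq0 e0 fe h1.
by rewrite /f /phi !mxE scale1r scale0r addr0 => /eqP; rewrite subr_eq0 => /eqP.
Qed.

End DerivativeRules.

(** * Brackets of the horizontal fields *)

Section PartialDerivative.
Variable R : realType.
Local Notation C := R[i].

(* Sealed so that unification never unfolds limits. *)
Fact pd_key : unit. Proof. exact: tt. Qed.
Definition pd n (v : 'rV[C]_n) (f : 'rV[C]_n -> C) : 'rV[C]_n -> C :=
  locked_with pd_key ('D_v f).

Lemma pdE n v (f : 'rV[C]_n -> C) : pd v f = 'D_v f.
Proof. by rewrite /pd unlock. Qed.

Section Rules.
Variable n : nat.
Implicit Types (f g : 'rV[C]_n -> C) (a v : 'rV[C]_n).

Lemma pdD f g a v : holomorphic_at f a -> holomorphic_at g a ->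
  pd v (fun x => f x + g x) a = pd v f a + pd v g a.
Proof. by rewrite !pdE; exact: derive_add. Qed.

Lemma pdM f g a v : holomorphic_at f a -> holomorphic_at g a ->
  pd v (fun x => f x * g x) a = pd v f a * g a + f a * pd v g a.
Proof. by rewrite !pdE; exact: derive_mul. Qed.

Lemma pd_sum (I : Type) (s : seq I) (F : I -> 'rV[C]_n -> C) a v :
  (forall i, holomorphic_at (F i) a) ->
  pd v (fun x => \sum_(i <- s) F i x) a = \sum_(i <- s) pd v (F i) a.
Proof.
move=> Fh; rewrite pdE (derive_sumh _ _ Fh).
by apply: eq_bigr => i _; rewrite pdE.
Qed.

Lemma pd_near0 f a v : (\forall x \near a, f x = 0) -> pd v f a = 0.
Proof. by rewrite pdE; exact: near_derive0. Qed.

Lemma pd_cst c a v : pd v (fun=> c) a = 0.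
Proof. by rewrite pdE; exact: derive_cst. Qed.

Lemma pd_near_eq f g a v : (\forall x \near a, f x = g x) -> pd v f a = pd v g a.
Proof. by rewrite !pdE; exact: near_eq_derive. Qed.

Lemma pdC f a i j : holomorphic_at f a ->
  pd (delta_mx 0 i) (pd (delta_mx 0 j) f) a =
  pd (delta_mx 0 j) (pd (delta_mx 0 i) f) a.
Proof. by move=> fh; rewrite !pdE; exact: deriveC. Qed.

Lemma pd_holo f a i : holomorphic_at f a ->
  holomorphic_at (pd (delta_mx 0 i) f) a.
Proof. by rewrite pdE; exact: holo_derive. Qed.

Lemma pd_dirD f a u v : holomorphic_at f a ->
  pd (u + v) f a = pd u f a + pd v f a.
Proof. by rewrite !pdE; exact: derive_dirD. Qed.

Lemma pd0 f a : pd 0 f a = 0.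
Proof. by rewrite pdE derive0. Qed.

Lemma pd_coord f a v : holomorphic_at f a ->
  pd v f a = \sum_i v 0 i * pd (delta_mx 0 i) f a.
Proof.
rewrite pdE => /derive_sum_coord ->.
by apply: eq_bigr => i _; rewrite pdE.
Qed.

Lemma pd_flat (P : ('rV[C]_n -> C) -> Prop) a :
  (forall f, P f -> f a = 0) ->
  (forall f i, P f -> P (pd (delta_mx 0 i) f)) ->
  forall f, P f -> holomorphic_at f a -> \forall x \near a, f x = 0.
Proof.
move=> P0 PD; apply: (holo_flat P0) => f i /(PD f i).
by rewrite pdE.
Qed.

End Rules.

Lemma pd_comp n m (F : 'rV[C]_m -> C) (G : 'rV[C]_n -> 'rV[C]_m) a v :
  holomorphic_at F (G a) -> (forall j, holomorphic_at (fun x => G x 0 j) a) ->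
  pd v (fun x => F (G x)) a = pd (\row_j pd v (fun x => G x 0 j) a) F (G a).
Proof.
move=> Fh Gh; rewrite pdE (derive_comp _ Fh Gh) pdE.
by congr derive; apply/rowP => j; rewrite !mxE pdE.
Qed.

End PartialDerivative.

Section Blocks.
Variable R : realType.
Local Notation C := R[i].
Variables M N : nat.
Implicit Types (y : 'rV[C]_(M + N)).

Definition ex (l : 'I_M) : 'rV[C]_(M + N) := delta_mx 0 (lshift N l).
Definition ez (k : 'I_N) : 'rV[C]_(M + N) := delta_mx 0 (rshift M k).

Lemma lsubmx_ex l : lsubmx (ex l) = delta_mx 0 l.
Proof. by apply/rowP => j; rewrite !mxE (inj_eq (@lshift_inj _ _)). Qed.

Lemma lsubmx_ez k : lsubmx (ez k) = 0.
Proof. by apply/rowP => j; rewrite !mxE eq_lrshift. Qed.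

Lemma pdisc_lsubmx r y : pdisc r y -> pdisc r (lsubmx y).
Proof. by move=> ry i; rewrite mxE; exact: ry. Qed.

Lemma pdisc_rsubmx r y : pdisc r y -> pdisc r (rsubmx y).
Proof. by move=> ry i; rewrite mxE; exact: ry. Qed.

Lemma near_lsubmx y (P : 'rV[C]_M -> Prop) :
  (\forall x \near lsubmx y, P x) -> \forall y' \near y, P (lsubmx y').
Proof.
move=> /nearP[r r0 rP]; apply/nearP; exists r => // z rz.
by rewrite linearD; exact/rP/pdisc_lsubmx.
Qed.

Lemma holo_lsubmx (c : 'rV[C]_M -> C) y : holomorphic_at c (lsubmx y) ->
  holomorphic_at (fun y => c (lsubmx y)) y.
Proof.
move=> ch; apply: (@holo_comp R _ _ c (fun y => lsubmx y) y ch) => i.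
rewrite (_ : (fun _ => _) = fun y : 'rV[C]_(M + N) => y 0 (lshift N i)).
  exact: holo_coord.
by apply/funext => z; rewrite mxE.
Qed.

Lemma pd_lsubmx_ex (c : 'rV[C]_M -> C) y l :
  pd (ex l) (fun y => c (lsubmx y)) y = pd (delta_mx 0 l) c (lsubmx y).
Proof. by rewrite !pdE derive_lsubmx lsubmx_ex. Qed.

Lemma pd_lsubmx_ez (c : 'rV[C]_M -> C) y k :
  pd (ez k) (fun y => c (lsubmx y)) y = 0.
Proof. by rewrite pdE derive_lsubmx lsubmx_ez derive0. Qed.

End Blocks.

Arguments ex {R M} N l.
Arguments ez {R} M {N} k.

Section Brackets.
Variables (R : realType) (M N : nat).
Local Notation C := R[i].
Variable omega : 'rV[C]_M -> 'M[C]_(M, N).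
Implicit Types (h : 'rV[C]_(M + N) -> C) (y : 'rV[C]_(M + N)).

(** The derivative of h along X_l, the horizontal lift of the coordinate field of x_l. *)
Definition hfield (l : 'I_M) h y : C :=
  pd (ex N l) h y + \sum_m omega (lsubmx y) l m * pd (ez M m) h y.

Lemma dcoefE i j k x : dcoef omega i j k x =
  pd (delta_mx 0 i) (fun x' => omega x' j k) x -
  pd (delta_mx 0 j) (fun x' => omega x' i k) x.
Proof. by rewrite !pdE. Qed.

Definition holo_omega (x : 'rV[C]_M) : Prop :=
  forall l m, holomorphic_at (fun x => omega x l m) x.

Lemma holo_omega_near x : holo_omega x -> \forall x' \near x, holo_omega x'.
Proof.
move=> oh.
pose P (lm : 'I_M * 'I_N) (x : 'rV[C]_M) :=
  holomorphic_at (fun x => omega x lm.1 lm.2) x.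
have : \forall x' \near x, forall lm, P lm x'.
  apply: (@filter_forall _ _ P (nbhs x)) => lm; exact: holo_near (oh lm.1 lm.2).
by apply: filterS => x' Px' l m; exact: Px' (l, m).
Qed.

Section AtPoint.
Variables (h : 'rV[C]_(M + N) -> C) (y0 : 'rV[C]_(M + N)).
Hypothesis hh : holomorphic_at h y0.
Hypothesis oh : holo_omega (lsubmx y0).

Let hxh l : holomorphic_at (pd (ex N l) h) y0.
Proof. exact: (pd_holo (lshift N l) hh). Qed.

Let hzh k : holomorphic_at (pd (ez M k) h) y0.
Proof. exact: (pd_holo (rshift M k) hh). Qed.

Let zxC k l : pd (ez M k) (pd (ex N l) h) y0 = pd (ex N l) (pd (ez M k) h) y0.
Proof. exact: (pdC (rshift M k) (lshift N l) hh). Qed.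

Let zzC k m : pd (ez M k) (pd (ez M m) h) y0 = pd (ez M m) (pd (ez M k) h) y0.
Proof. exact: (pdC (rshift M k) (rshift M m) hh). Qed.

Let xxC i j : pd (ex N i) (pd (ex N j) h) y0 = pd (ex N j) (pd (ex N i) h) y0.
Proof. exact: (pdC (lshift N i) (lshift N j) hh). Qed.

Let olh l m : holomorphic_at (fun y => omega (lsubmx y) l m) y0.
Proof. exact: (holo_lsubmx (oh l m)). Qed.

Lemma derive_combination (c : 'I_N -> 'rV[C]_M -> C) v :
  (forall k, holomorphic_at (c k) (lsubmx y0)) ->
  pd v (fun y => \sum_k c k (lsubmx y) * pd (ez M k) h y) y0 =
  \sum_k (pd v (fun y => c k (lsubmx y)) y0 * pd (ez M k) h y0 +
          c k (lsubmx y0) * pd v (pd (ez M k) h) y0).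
Proof.
move=> ch; have chl k := holo_lsubmx (ch k).
rewrite (pd_sum _ _ (fun k => holoM (chl k) (hzh k))).
by apply: eq_bigr => k _; exact: pdM (chl k) (hzh k).
Qed.

Hypothesis h0 : \forall y \near y0, forall l, hfield l h y = 0.

Lemma derive_hfield l v :
  pd v (pd (ex N l) h) y0 +
  \sum_m (pd v (fun y => omega (lsubmx y) l m) y0 * pd (ez M m) h y0 +
          omega (lsubmx y0) l m * pd v (pd (ez M m) h) y0) = 0.
Proof.
rewrite -(derive_combination v (fun m => oh l m)).
have sh : holomorphic_at
    (fun y => \sum_m omega (lsubmx y) l m * pd (ez M m) h y) y0.
  exact: (holo_sum _ (fun m => holoM (olh l m) (hzh m))).
rewrite -(pdD v (hxh l) sh).
by apply: (pd_near0 v (f := hfield l h)); apply: filterS h0 => y; apply.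
Qed.

Lemma hfield_ez l k : hfield l (pd (ez M k) h) y0 = 0.
Proof.
rewrite -[RHS](derive_hfield l (ez M k)) /hfield -zxC; congr (_ + _).
apply: eq_bigr => m _; rewrite (pd_lsubmx_ez (fun x => omega x l m)).
by rewrite mul0r add0r zzC.
Qed.

(** Differentiating the relation in x_l leaves an extra term B = sum of c_k d/dx_l (dh/dz_k). Since
    X_l kills dh/dz_k, this B is a combination of the sums of c_k d/dz_m (dh/dz_k), and these vanish
    because they are the derivatives of the same relation in z_m, where c does not vary. *)
Lemma combination_derive (c : 'I_N -> 'rV[C]_M -> C) l :
  (forall k, holomorphic_at (c k) (lsubmx y0)) ->
  (\forall y \near y0, \sum_k c k (lsubmx y) * pd (ez M k) h y = 0) ->
  \sum_k pd (delta_mx 0 l) (c k) (lsubmx y0) * pd (ez M k) h y0 = 0.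
Proof.
move=> ch c0.
have Dc v := etrans (esym (derive_combination v ch)) (pd_near0 v c0).
have Dx := Dc (ex N l); have Dz m := Dc (ez M m).
have {}Dz m : \sum_k c k (lsubmx y0) * pd (ez M m) (pd (ez M k) h) y0 = 0.
  rewrite -[RHS](Dz m); apply: eq_bigr => k _.
  by rewrite (pd_lsubmx_ez (c k)) mul0r add0r.
pose A := \sum_k pd (ex N l) (fun y => c k (lsubmx y)) y0 * pd (ez M k) h y0.
pose B := \sum_k c k (lsubmx y0) * pd (ex N l) (pd (ez M k) h) y0.
have AB : A + B = 0 by rewrite /A /B -big_split; exact: Dx.
have -> : \sum_k pd (delta_mx 0 l) (c k) (lsubmx y0) * pd (ez M k) h y0 = A.
  by apply: eq_bigr => k _; rewrite (pd_lsubmx_ex (c k)).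
suff B0 : B = 0 by move: AB; rewrite B0 addr0.
have E k : pd (ex N l) (pd (ez M k) h) y0 =
    - \sum_m omega (lsubmx y0) l m * pd (ez M m) (pd (ez M k) h) y0.
  by apply/eqP; rewrite -addr_eq0; apply/eqP; exact: hfield_ez.
have -> : B = - \sum_k \sum_m omega (lsubmx y0) l m *
    (c k (lsubmx y0) * pd (ez M m) (pd (ez M k) h) y0).
  rewrite -sumrN; apply: eq_bigr => k _; rewrite E mulrN mulr_sumr.
  by congr (- _); apply: eq_bigr => m _; rewrite mulrCA.
rewrite exchange_big /= big1 ?oppr0 // => m _.
by rewrite -mulr_sumr Dz mulr0.
Qed.

(** The bracket relation, obtained by differentiating X_b h = 0 in x_a: the term containing d
    omega_b / dx_a equals S a b minus the second derivative of h in x_a and x_b. Both are symmetric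
    in a and b, so antisymmetrizing leaves only d omega. *)
Lemma dcoef_annihilates i j :
  \sum_k dcoef omega i j k (lsubmx y0) * pd (ez M k) h y0 = 0.
Proof.
pose A a b := \sum_k pd (delta_mx 0 a) (fun x => omega x b k) (lsubmx y0) *
  pd (ez M k) h y0.
pose S a b := \sum_k \sum_m omega (lsubmx y0) a k * (omega (lsubmx y0) b m *
  pd (ez M m) (pd (ez M k) h) y0).
have SC a b : S a b = S b a.
  rewrite /S exchange_big /=; apply: eq_bigr => m _; apply: eq_bigr => k _.
  by rewrite mulrCA zzC.
have AS a b : A a b = S a b - pd (ex N a) (pd (ex N b) h) y0.
  pose B := \sum_m omega (lsubmx y0) b m * pd (ex N a) (pd (ez M m) h) y0.
  have BS : B = - S a b.
    rewrite SC /S -sumrN; apply: eq_bigr => k _.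
    have -> : pd (ex N a) (pd (ez M k) h) y0 =
        - \sum_m omega (lsubmx y0) a m * pd (ez M m) (pd (ez M k) h) y0.
      by apply/eqP; rewrite -addr_eq0; apply/eqP; exact: hfield_ez.
    by rewrite mulrN mulr_sumr.
  have DAB : pd (ex N a) (pd (ex N b) h) y0 + (A a b + B) = 0.
    rewrite -[RHS](derive_hfield b (ex N a)) /A /B -big_split.
    congr (_ + _); apply: eq_bigr => m _.
    by rewrite (pd_lsubmx_ex (fun x => omega x b m)).
  apply/eqP; rewrite -subr_eq0 -[X in _ == X]DAB BS; apply/eqP.
  by move: (A a b) (S a b) (pd _ _ _) => u v w; ring.
have -> : \sum_k dcoef omega i j k (lsubmx y0) * pd (ez M k) h y0 =
    A i j - A j i.
  by rewrite /A -sumrB; apply: eq_bigr => k _; rewrite dcoefE mulrBl.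
rewrite !AS SC.
by rewrite xxC subrr.
Qed.

End AtPoint.

Lemma near_hypotheses h y0 : holomorphic_at h y0 -> holo_omega (lsubmx y0) ->
  (\forall y \near y0, forall l, hfield l h y = 0) ->
  \forall y \near y0, [/\ holomorphic_at h y, holo_omega (lsubmx y) &
    \forall y' \near y, forall l, hfield l h y' = 0].
Proof.
move=> hh oh h0.
have ohn := holo_omega_near oh.
by apply: filterS3 (holo_near hh) (near_lsubmx ohn) (near_join h0) => y.
Qed.

Lemma dcoef_holo i j k x : holo_omega x -> holomorphic_at (dcoef omega i j k) x.
Proof.
move=> oh; have E := funext (dcoefE i j k); rewrite E.
exact: (holoB (pd_holo i (oh j k)) (pd_holo j (oh i k))).
Qed.

(* The relations [\sum_k c k x * pd (ez M k) h (x, z) = 0] can be differentiated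
   in [x], because the derivatives of [h] in [z] are first integrals too. *)
Lemma dcoef_flat h y0 i j : holomorphic_at h y0 -> holo_omega (lsubmx y0) ->
  (\forall y \near y0, forall l, hfield l h y = 0) ->
  \forall x \near lsubmx y0, \sum_k dcoef omega i j k x * pd (ez M k) h y0 = 0.
Proof.
move=> hh oh h0; have hn := near_hypotheses hh oh h0.
(* In f the z-derivatives of [h] are frozen at [y0], whereas the relation on the c_k is kept at all
   y near [y0]: it is this second form that [combination_derive] passes on to the derivatives of the
   c_k. *)
pose P (f : 'rV[C]_M -> C) := exists c : 'I_N -> 'rV[C]_M -> C,
  [/\ forall k, holomorphic_at (c k) (lsubmx y0),
      \forall y \near y0, \sum_k c k (lsubmx y) * pd (ez M k) h y = 0 &
      \forall x \near lsubmx y0, f x = \sum_k c k x * pd (ez M k) h y0].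
have P0 f : P f -> f (lsubmx y0) = 0.
  move=> [c [_ c0 fc]]; rewrite (nbhs_singleton fc).
  exact: (nbhs_singleton c0).
have PD f l : P f -> P (pd (delta_mx 0 l) f).
  move=> [c [ch c0 fc]]; exists (fun k => pd (delta_mx 0 l) (c k)).
  have chn : \forall x \near lsubmx y0, forall k, holomorphic_at (c k) x.
    by apply: (@filter_forall _ _ (fun k x => holomorphic_at (c k) x)
        (nbhs (lsubmx y0))) => k;
      exact: holo_near.
  split=> [k||]; first exact: pd_holo.
    apply: filterS3 hn (near_lsubmx chn) (near_join c0) => y [hy oy h0y] cy c0y.
    exact: (combination_derive hy oy h0y l cy c0y).
  apply: filterS2 (near_join fc) chn => x fcx cx.
  rewrite (pd_near_eq _ fcx).
  have ch1 k : holomorphic_at (fun x => c k x * pd (ez M k) h y0) x.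
    exact: (holoM (cx k) (holo_cst _ _)).
  rewrite (pd_sum _ _ ch1); apply: eq_bigr => k _.
  by rewrite (pdM _ (cx k) (holo_cst _ _)) pd_cst mulr0 addr0.
have ohn := holo_omega_near oh.
apply: (pd_flat P0 PD); last first.
  apply: holo_sum => k; apply: holoM (holo_cst _ _).
  exact: (dcoef_holo i j k oh).
exists (fun k => dcoef omega i j k); split=> [k||].
- exact: (dcoef_holo i j k oh).
- apply: filterS hn => y [hy oy h0y].
  exact: (dcoef_annihilates hy oy h0y).
- exact: filterE.
Qed.

End Brackets.

(** * From the quotient to first integrals *)

Section Span.
Variable R : realType.
Local Notation C := R[i].

Lemma ana_comb n p r (F : 'I_p -> 'rV[C]_n -> C) (lam : 'I_p -> C) :
  (forall k, exists B, ana r B (F k)) ->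
  exists B, ana r B (fun x => \sum_k F k x * lam k).
Proof.
move=> FB; elim: (index_enum _) => [|k s [B IH]].
  exists (nrm (0 : C)); apply: eq_ana (ana_cst n r 0) => x _.
  by rewrite big_nil.
have [D FD] := FB k; exists (nrm (lam k) * D + B).
apply: eq_ana (anaD (anaZ (lam k) FD) IH) => x _.
by rewrite big_cons mulrC.
Qed.

(** The radius is fixed before [lam]: it comes from the convergence of the F_k alone. The norm of
    the combination does depend on [lam], but the identity theorem never uses its size. In the
    application [lam] consists of derivatives of h at a point that is chosen afterwards. *)
Lemma uniform_identity n p (F : 'I_p -> 'rV[C]_n -> C) :
  (forall k, holomorphic_at (F k) 0) ->
  exists r0, 0 < r0 /\ forall r, 0 < r -> r <= r0 -> forall lam q, pdisc r q ->
    (\forall x \near q, \sum_k F k x * lam k = 0) ->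
    \forall x \near (0 : 'rV[C]_n), \sum_k F k x * lam k = 0.
Proof.
move=> Fh.
have [k|r0 [r00 r0P]] := @min_radius R 'I_p (fun k r => exists B, ana r B (F k)).
  have [r0 [B [r00 FB]]] := holo_radius (Fh k); exists r0; split=> // r r_0 rr0.
  by exists B; apply: eq_ana (FB r r_0 rr0) => x _; rewrite add0r.
exists (r0 / 3); split=> [|r r_0 rr0 lam q rq Fq]; first by rewrite divr_gt0.
have [B FB] := ana_comb lam (r0P r0 r00 (lexx _)).
have rr : r + r < r0 by lra.
have F0 := ana_identity r_0 rr FB rq Fq.
apply/nearP; exists r0; first exact: r00.
by move=> x rx; rewrite add0r; exact: F0.
Qed.

Variables (M N : nat) (omega : 'rV[C]_M -> 'M[C]_(M, N)).

(** Applying [lam] to [c K i j] gives the coefficient at K of a function vanishing near 0, so each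
    [c K i j] lies in the kernel of [lam]; by minimality W is contained in that kernel. *)
Lemma WD_linform_eq0 (W : {vspace 'rV[C]_N}) (lam : 'I_N -> C) :
  is_WD omega W ->
  (forall i j, \forall x \near (0 : 'rV[C]_M),
     \sum_k dcoef omega i j k x * lam k = 0) ->
  forall w, w \in W -> linform lam w = 0.
Proof.
move=> [c [cexp _ cmin]] lam0.
pose V := lker (linfun (mulmxr (\col_k lam k)) : 'Hom('rV[C]_N, 'rV[C]_1)).
have inV w : w \in V <-> linform lam w = 0.
  have E : (w *m \col_k lam k) 0 0 = linform lam w.
    by rewrite mxE; apply: eq_bigr => k _; rewrite mxE.
  rewrite memv_ker lfunE /= -E; split=> [/eqP ->|w0]; first by rewrite mxE.
  by apply/eqP/matrixP => i j; rewrite (ord1 i) (ord1 j) w0 mxE.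
have /subvP WV : (W <= V)%VS; last by move=> w /WV /inV.
apply: cmin => K i j ij; apply/inV.
have [r [B [r0 dB]]] : exists r B, 0 < r /\
    anac r B (fun x => \sum_k dcoef omega i j k (0 + x) * lam k)
      (fun K => \sum_k c K i j 0 k * lam k).
  have hk k : exists r0, 0 < r0 /\ forall r, 0 < r -> r <= r0 ->
      exists B, anac r B (fun x => dcoef omega i j k (0 + x)) (fun K => c K i j 0 k).
    have [r [B [r0 dB]]] := pseries_anac (cexp i j k ij).
    exists r; split=> // s s0 sr; exists B.
    exact: anac_le (ltW s0) sr (lexx B) dB.
  have [r [r0 rP]] := min_radius hk.
  have {rP} := rP r r0 (lexx r).
  move=> /choice[B dB]; exists r.
  elim: (index_enum _) => [|k s [D [_ IH]]].
    exists 0; split=> //; split=> [A|x _].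
      by rewrite big1 // => L _; rewrite big_nil mul0r nrm0.
    move=> e e0; exists fset0 => A _.
    by rewrite big_nil big1 ?subrr ?nrm0 // => L _; rewrite big_nil mul0r.
  case: IH (dB k) => IH1 IH2 [dk1 dk2].
  exists (nrm (lam k) * B k + D); split=> //; split=> [A|x rx].
    apply: le_trans (lerD (ler_wpM2l (nrm_ge0 _) (dk1 A)) (IH1 A)).
    rewrite mulr_sumr -big_split /= ler_sum // => L _.
    by rewrite big_cons mulrDl (le_trans (nrmD _ _)) // lerD2r [_ * lam k]mulrC -mulrA nrmM.
  have h := sumsD (sumsZ (lam k) (dk2 x rx)) (IH2 x rx).
  suff -> : \sum_(k <- k :: s) dcoef omega i j k (0 + x) * lam k =
      lam k * dcoef omega i j k (0 + x) +
      \sum_(k <- s) dcoef omega i j k (0 + x) * lam k.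
    apply: eq_sums h => L.
    by rewrite big_cons mulrDl mulrA; congr (_ * _ + _); exact: mulrC.
  by rewrite big_cons; congr (_ + _); exact: mulrC.
have l0 : \forall x \near (0 : 'rV[C]_M),
    \sum_k dcoef omega i j k (0 + x) * lam k = 0.
  by apply: filterS (lam0 i j) => x; rewrite add0r.
exact: (anac_coef0 r0 dB l0).
Qed.

End Span.

(** * The map H, its differential, and pullbacks by H *)

Section FirstIntegralMap.
Variable R : realType.
Local Notation C := R[i].

Lemma lfun_coord n m (L : 'Hom('rV[C]_n, 'rV[C]_m)) u k :
  L u 0 k = \sum_j u 0 j * L (delta_mx 0 j) 0 k.
Proof.
rewrite {1}(row_sum_delta u) linear_sum summxE; apply: eq_bigr => j _.
by rewrite linearZ mxE.
Qed.

Lemma holo_lfun n m p (L : 'Hom('rV[C]_n, 'rV[C]_m)) (G : 'rV[C]_p -> 'rV[C]_n) a k :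
  (forall j, holomorphic_at (fun x => G x 0 j) a) ->
  holomorphic_at (fun x => L (G x) 0 k) a.
Proof.
move=> Gh; have E := funext (fun x => lfun_coord L (G x) k); rewrite E.
by apply: holo_sum => j; exact: holoM (Gh j) (holo_cst _ _).
Qed.

Lemma pd_lfun n m p (L : 'Hom('rV[C]_n, 'rV[C]_m)) (G : 'rV[C]_p -> 'rV[C]_n) a v k :
  (forall j, holomorphic_at (fun x => G x 0 j) a) ->
  pd v (fun x => L (G x) 0 k) a = L (\row_j pd v (fun x => G x 0 j) a) 0 k.
Proof.
move=> Gh; have E := funext (fun x => lfun_coord L (G x) k); rewrite E.
rewrite (pd_sum _ _ (fun j => holoM (Gh j) (holo_cst _ (L (delta_mx 0 j) 0 k)))).
rewrite lfun_coord; apply: eq_bigr => j _.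
by rewrite (pdM _ (Gh j) (holo_cst _ _)) pd_cst mulr0 addr0 mxE.
Qed.

Lemma pdB n (f g : 'rV[C]_n -> C) a v : holomorphic_at f a -> holomorphic_at g a ->
  pd v (fun x => f x - g x) a = pd v f a - pd v g a.
Proof.
by move=> fh gh; rewrite !pdE; apply: deriveB; exact: holo_derivable.
Qed.

Lemma pd_entry n (a v : 'rV[C]_n) j : pd v (fun x : 'rV[C]_n => x 0 j) a = v 0 j.
Proof. by rewrite pdE derive_coord. Qed.

Lemma near_comp_row n m (G : 'rV[C]_n -> 'rV[C]_m) a (P : 'rV[C]_m -> Prop) :
  (forall j, holomorphic_at (fun x => G x 0 j) a) ->
  (\forall u \near G a, P u) -> \forall x \near a, P (G x).
Proof.
move=> Gh /nearP[r r0 rP]; apply: filterS (holo_row_near Gh r0) => x /rP.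
by rewrite addrC subrK.
Qed.

Lemma near_forall_holo n m (G : 'rV[C]_n -> 'rV[C]_m) a :
  (forall j, holomorphic_at (fun x => G x 0 j) a) ->
  \forall x \near a, forall j, holomorphic_at (fun x => G x 0 j) x.
Proof.
move=> Gh; apply: (@filter_forall _ _ (fun j => holomorphic_at (fun x => G x 0 j))
  (nbhs a)) => j.
exact: holo_near.
Qed.

Section Blocks.
Variables M N : nat.

Lemma holo_lsub_entry (y : 'rV[C]_(M + N)) i :
  holomorphic_at (fun y => lsubmx y 0 i) y.
Proof.
rewrite (_ : (fun _ => _) = fun y : 'rV[C]_(M + N) => y 0 (lshift N i)).
  exact: holo_coord.
by apply/funext => z; rewrite mxE.
Qed.

Lemma holo_rsub_entry (y : 'rV[C]_(M + N)) k :
  holomorphic_at (fun y => rsubmx y 0 k) y.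
Proof.
rewrite (_ : (fun _ => _) = fun y : 'rV[C]_(M + N) => y 0 (rshift M k)).
  exact: holo_coord.
by apply/funext => z; rewrite mxE.
Qed.

Lemma pd_lsub_entry (y v : 'rV[C]_(M + N)) i :
  pd v (fun y => lsubmx y 0 i) y = lsubmx v 0 i.
Proof.
rewrite (_ : (fun _ => _) = fun y : 'rV[C]_(M + N) => y 0 (lshift N i)).
  by rewrite pd_entry mxE.
by apply/funext => z; rewrite mxE.
Qed.

Lemma pd_rsub_entry (y v : 'rV[C]_(M + N)) k :
  pd v (fun y => rsubmx y 0 k) y = rsubmx v 0 k.
Proof.
rewrite (_ : (fun _ => _) = fun y : 'rV[C]_(M + N) => y 0 (rshift M k)).
  by rewrite pd_entry mxE.
by apply/funext => z; rewrite mxE.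
Qed.

Lemma pd_lsubmx (c : 'rV[C]_M -> C) (y v : 'rV[C]_(M + N)) :
  pd v (fun y => c (lsubmx y)) y = pd (lsubmx v) c (lsubmx y).
Proof. by rewrite !pdE; exact: derive_lsubmx. Qed.

Lemma holo_row_mx n (A : 'rV[C]_n -> 'rV[C]_M) (B : 'rV[C]_n -> 'rV[C]_N) a :
  (forall i, holomorphic_at (fun x => A x 0 i) a) ->
  (forall k, holomorphic_at (fun x => B x 0 k) a) ->
  forall j, holomorphic_at (fun x => row_mx (A x) (B x) 0 j) a.
Proof.
move=> Ah Bh j; case: (split_ordP j) => [i ->|k ->].
  have E := funext (fun x => row_mxEl (A x) (B x) 0 i); rewrite E; exact: Ah.
have E := funext (fun x => row_mxEr (A x) (B x) 0 k); rewrite E; exact: Bh.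
Qed.

Lemma pd_row_mx n (A : 'rV[C]_n -> 'rV[C]_M) (B : 'rV[C]_n -> 'rV[C]_N) a v :
  \row_j pd v (fun x => row_mx (A x) (B x) 0 j) a =
  row_mx (\row_i pd v (fun x => A x 0 i) a) (\row_k pd v (fun x => B x 0 k) a).
Proof.
apply/rowP => j; rewrite mxE; case: (split_ordP j) => [i ->|k ->].
  have E := funext (fun x => row_mxEl (A x) (B x) 0 i).
  by rewrite E row_mxEl mxE.
have E := funext (fun x => row_mxEr (A x) (B x) 0 k).
by rewrite E row_mxEr mxE.
Qed.

End Blocks.

Section HD.
Variables (M N kappa : nat) (T : 'Hom('rV[C]_N, 'rV[C]_kappa)).
Variable g : 'rV[C]_M -> 'rV[C]_kappa.

Lemma HD_entry y j : HD T g y 0 j = T (rsubmx y) 0 j - g (lsubmx y) 0 j.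
Proof. by rewrite /HD !mxE. Qed.

Lemma holo_HD (y : 'rV[C]_(M + N)) :
  (forall j, holomorphic_at (fun x => g x 0 j) (lsubmx y)) ->
  forall j, holomorphic_at (fun y => HD T g y 0 j) y.
Proof.
move=> gh j; have E := funext (fun y => HD_entry y j); rewrite E.
apply: holoB; last exact: (holo_lsubmx (gh j)).
by apply: (holo_lfun T) => k; exact: holo_rsub_entry.
Qed.

Lemma pd_HD (y v : 'rV[C]_(M + N)) j :
  (forall j, holomorphic_at (fun x => g x 0 j) (lsubmx y)) ->
  pd v (fun y => HD T g y 0 j) y =
  T (rsubmx v) 0 j - pd (lsubmx v) (fun x => g x 0 j) (lsubmx y).
Proof.
move=> gh; have E := funext (fun y => HD_entry y j); rewrite E.
have rh := @holo_rsub_entry M N y.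
rewrite (pdB _ (holo_lfun T j rh) (holo_lsubmx (gh j))).
rewrite (pd_lfun _ _ _ rh) (pd_lsubmx (fun x => g x 0 j)).
by congr (T _ 0 j - _); apply/rowP => k; rewrite mxE pd_rsub_entry.
Qed.

Variable omega : 'rV[C]_M -> 'M[C]_(M, N).
Hypothesis oh : holo_omega omega 0.
Hypothesis hg : is_primitive omega T g.

Lemma HD0 : HD T g 0 = 0.
Proof. by case: hg => _ g0 _; rewrite /HD !linear0 g0 subrr. Qed.

(** Depends on y only through its x part, so it holds at p as soon as it holds at [shear p]. *)
Definition regular (y : 'rV[C]_(M + N)) : Prop :=
  [/\ holo_omega omega (lsubmx y),
      forall j, holomorphic_at (fun x => g x 0 j) (lsubmx y) &
      forall v j, pd v (fun x => g x 0 j) (lsubmx y) =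
        T (v *m omega (lsubmx y)) 0 j].

Lemma near_regular : \forall y \near (0 : 'rV[C]_(M + N)), regular y.
Proof.
have [gh _ gT] := hg.
have l0 : lsubmx (0 : 'rV[C]_(M + N)) = 0 by exact: linear0.
pose P x := [/\ holo_omega omega x,
    forall j, holomorphic_at (fun x => g x 0 j) x &
    forall v j, pd v (fun x => g x 0 j) x = T (v *m omega x) 0 j].
have : \forall x \near lsubmx (0 : 'rV[C]_(M + N)), P x.
  rewrite l0.
  apply: filterS3 (holo_omega_near oh) (near_forall_holo gh) gT => x ox gx Tx.
  by split=> // v j; rewrite pdE.
exact: (near_lsubmx (P := P)).
Qed.

Lemma pd_HD_distribution (y u : 'rV[C]_(M + N)) : regular y ->
  distribution omega y u -> \row_j pd u (fun y => HD T g y 0 j) y = 0.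
Proof.
move=> [_ gh gT] du; apply/rowP => j.
by rewrite !mxE (pd_HD _ _ gh) gT du subrr.
Qed.

(** Let n and d be the numerator and denominator of f composed with H. Cancelling the denominator of
    F gives h d = n near y; differentiating along the distribution, which kills n and d, gives d
    times the derivative of h equal to 0, and d is cancelled. Both cancellations are made in the
    ring of germs at y, since either denominator may vanish at y itself. *)
Lemma pullback_first_integral (F : mero_germ R (M + N)) (f : mero_germ R kappa) :
  mero_pullback F f (HD T g) -> first_integral omega F.
Proof.
move=> [dn0 rel].
have Gh0 : forall j, holomorphic_at (fun y : 'rV[C]_(M + N) => HD T g y 0 j) 0.
  by apply: holo_HD; rewrite linear0; case: hg.
have nh0 : holomorphic_at (num f) (HD T g 0) by rewrite HD0; exact: num_holo.
have dh0 : holomorphic_at (den f) (HD T g 0) by rewrite HD0; exact: den_holo.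
have nhn := near_comp_row Gh0 (holo_near nh0).
have dhn := near_comp_row Gh0 (holo_near dh0).
have dnn := holo_neq0_near (holo_comp dh0 Gh0) dn0.
have Qn := holo_neq0_near (den_holo F) (@den_neq0 _ _ F).
have Qh := holo_near (den_holo F).
have good : \forall y \near (0 : 'rV[C]_(M + N)), [/\ regular y,
    holomorphic_at (num f) (HD T g y), holomorphic_at (den f) (HD T g y) &
    num F y * den f (HD T g y) = num f (HD T g y) * den F y].
  by apply: filterS3 (filterI near_regular rel) nhn dhn => y [].
apply: filterS3 (near_join good) dnn (filterI Qn Qh) => y gy dny [Qny Qhy].
move=> h [hh hF] u du.
have [[oy gy0 _] nhy dhy _] := nbhs_singleton gy.
have Gh := holo_HD gy0.
pose d y' := den f (HD T g y'); pose n y' := num f (HD T g y').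
have dh : holomorphic_at d y := holo_comp dhy Gh.
have nh : holomorphic_at n y := holo_comp nhy Gh.
have hd0 : \forall y' \near y, h y' * d y' - n y' = 0.
  apply: (holo_mul_eq0 Qhy (holoB (holoM hh dh) nh) _ Qny).
  apply: filterS2 gy hF => y' [_ _ _ ry'] hFy'.
  by rewrite mulrBr mulrA [den F y' * h y']mulrC -hFy' /d ry' /n mulrC subrr.
(* The vector u is extended to a holomorphic section of the distribution: cancelling d requires a
   relation on a whole neighbourhood of y. *)
pose U (y' : 'rV[C]_(M + N)) : 'rV[C]_(M + N) :=
  row_mx (lsubmx u) (lsubmx u *m omega (lsubmx y')).
have Uy : U y = u by rewrite /U -du hsubmxK.
have Ud y' : distribution omega y' (U y').
  by rewrite /distribution /= /U row_mxKl row_mxKr.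
have Xh : holomorphic_at (fun y' => pd (U y') h y') y.
  apply: (@near_eq_holo _ _ (fun y' => \sum_j U y' 0 j * pd (delta_mx 0 j) h y')).
    by apply: filterS (holo_near hh) => y' hy'; rewrite (pd_coord _ hy').
  apply: holo_sum => j; apply: holoM (pd_holo j hh).
  apply: (holo_row_mx (A := fun=> lsubmx u)
    (B := fun y' => lsubmx u *m omega (lsubmx y'))) => [i|k].
    exact: holo_cst.
  rewrite (_ : (fun _ => _) =
      fun y' => \sum_l lsubmx u 0 l * omega (lsubmx y') l k).
    apply: holo_sum => l; apply: holoM (holo_cst _ _) _.
    exact: (holo_lsubmx (oy l k)).
  by apply/funext => y'; rewrite mxE.
have dX : \forall y' \near y, d y' * pd (U y') h y' = 0.
  apply: filterS3 gy (near_join hd0) (holo_near hh) => y' [ry' nhy' dhy' _] hd0' hy'.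
  have [_ gy' _] := ry'; have Gh' := holo_HD gy'.
  have dh' : holomorphic_at d y' := holo_comp dhy' Gh'.
  have nh' : holomorphic_at n y' := holo_comp nhy' Gh'.
  have := pd_near0 (U y') hd0'.
  rewrite (pdB _ (holoM hy' dh') nh') (pdM _ hy' dh').
  rewrite (pd_comp _ dhy' Gh') (pd_comp _ nhy' Gh').
  rewrite (pd_HD_distribution ry' (Ud y')) !pd0 mulr0 addr0 subr0.
  by rewrite mulrC.
have := nbhs_singleton (holo_mul_eq0 dh Xh dX dny).
by rewrite Uy pdE.
Qed.

End HD.
End FirstIntegralMap.

(** * From first integrals to the quotient *)

Section Local.
Variables (R : realType) (M N : nat).
Local Notation C := R[i].
Variable omega : 'rV[C]_M -> 'M[C]_(M, N).

Lemma pdisc_near n r s (q : 'rV[C]_n) : pdisc s q -> s < r ->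
  \forall y \near q, pdisc r y.
Proof.
move=> sq sr; apply/nearP; exists (r - s); first by rewrite subr_gt0.
by move=> x rx; rewrite -(subrK s r) addrC; exact: pdiscD.
Qed.

Lemma pd_block (h : 'rV[C]_(M + N) -> C) y a b : holomorphic_at h y ->
  pd (row_mx a b) h y =
  \sum_i a 0 i * pd (ex N i) h y + \sum_k b 0 k * pd (ez M k) h y.
Proof.
move=> hh; rewrite (pd_coord _ hh) big_split_ord /=.
by congr (_ + _); apply: eq_bigr => i _; rewrite ?row_mxEl ?row_mxEr.
Qed.

Definition invariant (h : 'rV[C]_(M + N) -> C) y : Prop :=
  forall a, pd (row_mx a (a *m omega (lsubmx y))) h y = 0.

Lemma invariant_hfield h y l : holomorphic_at h y -> invariant h y ->
  hfield omega l h y = 0.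
Proof.
move=> hh /(_ (delta_mx 0 l)); rewrite (pd_block _ _ hh) /hfield => E; rewrite -[RHS]E.
congr (_ + _).
  rewrite (bigD1 l) //= mxE !eqxx mul1r big1 ?addr0 // => i /negbTE il.
  by rewrite mxE il andbF mul0r.
by apply: eq_bigr => k _; rewrite -rowE mxE.
Qed.

(** One radius serves all h and y0, since h enters only through the coefficients of a combination of
    the functions [dcoef]. It constrains only the x part of y0, these functions being independent of
    z. *)
Lemma invariant_WD (W : {vspace 'rV[C]_N}) : is_WD omega W -> holo_omega omega 0 ->
  exists r, 0 < r /\ forall h y0, pdisc r (lsubmx y0) ->
    holomorphic_at h y0 -> holo_omega omega (lsubmx y0) ->
    (\forall y \near y0, invariant h y) ->
    forall w, w \in W -> pd (row_mx 0 w) h y0 = 0.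
Proof.
move=> WD oh.
have hF (ij : 'I_M * 'I_M) k : holomorphic_at (dcoef omega ij.1 ij.2 k) 0.
  exact: (dcoef_holo _ _ _ oh).
have [r [r0 rP]] := min_radius (fun ij => uniform_identity (hF ij)).
exists r; split=> // h y0 ry0 hh oy0 h0 w wW.
rewrite (pd_block _ _ hh) big1 ?add0r => [|i _]; last by rewrite mxE mul0r.
apply: (WD_linform_eq0 WD _ wW) => i j.
apply: (rP r r0 (lexx r) (i, j) _ _ ry0).
apply: (dcoef_flat _ _ hh oy0).
by apply: filterS2 h0 (holo_near hh) => y hy hhy l; exact: invariant_hfield.
Qed.

End Local.

(** * Straightening H and descending F to the quotient *)

Section Pullback.
Variables (R : realType) (M N kappa : nat).
Local Notation C := R[i].
Variables (omega : 'rV[C]_M -> 'M[C]_(M, N)) (W : {vspace 'rV[C]_N}).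
Variables (T : 'Hom('rV[C]_N, 'rV[C]_kappa)) (g : 'rV[C]_M -> 'rV[C]_kappa).
Hypotheses (oh : holo_omega omega 0) (WD : is_WD omega W).
Hypotheses (Tsurj : limg T = fullv) (Tker : lker T = W).
Hypothesis hg : is_primitive omega T g.
Local Notation H := (HD T g).
Local Notation s := (T^-1)%VF.

Lemma sectionK t : T (s t) = t.
Proof. by apply: limg_lfunVK; rewrite Tsurj memvf. Qed.

Lemma T_eq0 w : (w \in W) = (T w == 0).
Proof. by rewrite -Tker memv_ker. Qed.

(** A change of coordinates that straightens H: [H (shear p)] is [T (rsubmx p)], so the fibres
    become translates of C^M x W. *)
Definition shear (p : 'rV[C]_(M + N)) : 'rV[C]_(M + N) :=
  row_mx (lsubmx p) (rsubmx p + s (g (lsubmx p))).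
Definition unshear (y : 'rV[C]_(M + N)) : 'rV[C]_(M + N) :=
  row_mx (lsubmx y) (rsubmx y - s (g (lsubmx y))).

Lemma unshearK y : shear (unshear y) = y.
Proof. by rewrite /shear /unshear row_mxKl row_mxKr subrK hsubmxK. Qed.

Lemma holo_section_g p : (forall j, holomorphic_at (fun x => g x 0 j) (lsubmx p)) ->
  forall k, holomorphic_at (fun p : 'rV[C]_(M + N) => s (g (lsubmx p)) 0 k) p.
Proof.
move=> gh k; apply: (holo_lfun s) => j; exact: (holo_lsubmx (gh j)).
Qed.

Lemma holo_shear p : (forall j, holomorphic_at (fun x => g x 0 j) (lsubmx p)) ->
  forall j, holomorphic_at (fun p => shear p 0 j) p.
Proof.
move=> gh; apply: (holo_row_mx (A := fun p => lsubmx p)) => [i|k].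
  exact: holo_lsub_entry.
rewrite (_ : (fun _ => _) =
    fun p : 'rV[C]_(M + N) => rsubmx p 0 k + s (g (lsubmx p)) 0 k).
  exact: (holoD (holo_rsub_entry _ _) (holo_section_g gh k)).
by apply/funext => q; rewrite mxE.
Qed.

Lemma holo_unshear p : (forall j, holomorphic_at (fun x => g x 0 j) (lsubmx p)) ->
  forall j, holomorphic_at (fun p => unshear p 0 j) p.
Proof.
move=> gh; apply: (holo_row_mx (A := fun p => lsubmx p)) => [i|k].
  exact: holo_lsub_entry.
rewrite (_ : (fun _ => _) =
    fun p : 'rV[C]_(M + N) => rsubmx p 0 k - s (g (lsubmx p)) 0 k).
  exact: (holoB (holo_rsub_entry _ _) (holo_section_g gh k)).
by apply/funext => q; rewrite !mxE.
Qed.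

Lemma pd_shear p v : regular T g omega p ->
  \row_j pd v (fun p => shear p 0 j) p =
  row_mx (lsubmx v) (rsubmx v + s (T (lsubmx v *m omega (lsubmx p)))).
Proof.
move=> [_ gh gT]; rewrite pd_row_mx; congr row_mx; apply/rowP => k; rewrite mxE.
  exact: pd_lsub_entry.
rewrite (_ : (fun _ => _) =
    fun p : 'rV[C]_(M + N) => rsubmx p 0 k + s (g (lsubmx p)) 0 k); last first.
  by apply/funext => q; rewrite mxE.
rewrite (pdD _ (holo_rsub_entry _ _) (holo_section_g gh k)) pd_rsub_entry.
rewrite (pd_lfun s _ _ (fun j => holo_lsubmx (gh j))) [RHS]mxE.
congr (_ + s _ 0 k); apply/rowP => j.
by rewrite mxE (pd_lsubmx (fun x => g x 0 j)) gT.
Qed.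

(* In the coordinates [unshear] the leaves of [H] are affine. *)
Lemma invariant_leaf h y1 : regular T g omega y1 -> holomorphic_at h y1 ->
  (\forall y \near y1, regular T g omega y) ->
  (\forall y \near y1, forall a w, w \in W ->
     pd (row_mx a (a *m omega (lsubmx y) + w)) h y = 0) ->
  exists2 r, 0 < r & forall y y',
    pdisc r (unshear y' - unshear y1) -> pdisc r (unshear y - unshear y') ->
    H y = H y' -> h y = h y'.
Proof.
move=> reg1 hh regn h0; have [_ gh1 _] := reg1.
have lp : lsubmx (unshear y1) = lsubmx y1 by rewrite row_mxKl.
have ghp : forall j, holomorphic_at (fun x => g x 0 j) (lsubmx (unshear y1)).
  by rewrite lp.
have hhp : holomorphic_at h (shear (unshear y1)) by rewrite unshearK.
have kh := holo_comp hhp (holo_shear ghp).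
have hall : \forall y \near shear (unshear y1), [/\ regular T g omega y,
    holomorphic_at h y & forall a w, w \in W ->
     pd (row_mx a (a *m omega (lsubmx y) + w)) h y = 0].
  by rewrite unshearK; apply: filterS3 regn (holo_near hh) h0 => y.
pose S : set 'rV[C]_(M + N) := [set v | rsubmx v \in W].
have [|r r0 rP] := @line_const R _ (fun p => h (shear p)) (unshear y1) S kh.
  apply: filterS (near_comp_row (holo_shear ghp) hall) => p [regp hp h0p] v Sv.
  have lsp : lsubmx (shear p) = lsubmx p by rewrite row_mxKl.
  have regp' : regular T g omega p by move: regp; rewrite /regular lsp.
  have [_ ghp' _] := regp'.
  suff : pd v (fun p => h (shear p)) p = 0 by rewrite pdE.
  rewrite (pd_comp _ hp (holo_shear ghp')) (pd_shear _ regp').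
  set b := lsubmx v *m _.
  (* The image of v under the differential of [shear] is the horizontal vector (a, b) plus a
     vertical correction, which lies in W because T kills s (T b) - b and [rsubmx v] is in W. *)
  have -> : rsubmx v + s (T b) = b + (rsubmx v + (s (T b) - b)).
    by rewrite addrCA [b + _]addrC subrK.
  rewrite /b -lsp; apply: h0p; rewrite memvD // T_eq0 linearB /=.
  by rewrite sectionK subrr.
exists r => // y y' ry' ry Hyy'.
have := rP _ _ ry' ry; rewrite [unshear y1 + _]addrC subrK [_ + (_ - _)]addrC subrK !unshearK.
apply; rewrite /S /= T_eq0 /unshear opp_row_mx add_row_mx row_mxKr opprB.
move: Hyy'; rewrite /HD => /eqP; rewrite -subr_eq0 => /eqP Hyy'.
by rewrite !linearD !linearN /= !sectionK -Hyy'; apply/eqP; rewrite opprB.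
Qed.

Lemma ana0_radius n (f : 'rV[C]_n -> C) : holomorphic_at f 0 ->
  exists r0 B, 0 < r0 /\ forall r, 0 < r -> r <= r0 -> ana r B f.
Proof.
move=> /holo_radius[r0 [B [r00 fB]]]; exists r0, B; split=> // r r_0 rr0.
by apply: eq_ana (fB r r_0 rr0) => x _; rewrite add0r.
Qed.

Lemma row_small n m (G : 'rV[C]_n -> 'rV[C]_m) e :
  (forall j, holomorphic_at (fun x => G x 0 j) 0) -> G 0 = 0 -> 0 < e ->
  exists r0, 0 < r0 /\ forall r, 0 < r -> r <= r0 ->
    forall j, ana r e (fun x => G x 0 j).
Proof.
move=> Gh G0 e0; apply: min_radius => j.
have [|r0 [r00 r0P]] := holo_small (Gh j) _ e0; first by rewrite G0 mxE.
exists r0; split=> // r r_0 rr0.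
by apply: eq_ana (r0P r r_0 rr0) => x _; rewrite add0r.
Qed.

Lemma near_radius n (P : 'rV[C]_n -> Prop) :
  (\forall x \near (0 : 'rV[C]_n), P x) ->
  exists r0, 0 < r0 /\ forall x, pdisc r0 x -> P x.
Proof.
by move=> /nearP[r r0 rP]; exists r; split=> // x /rP; rewrite add0r.
Qed.

(** With V = s and V = s o H this expands A o sigma and A o sigma o H on the same polydisc. The
    shares rho / 2 for e and rho / 4 for V keep the argument of A within rho. *)
Lemma ana_row_mx m r rho B (A : 'rV[C]_(M + N) -> C) x0 e (V : 'rV[C]_m -> 'rV[C]_N) :
  0 < r -> 0 < rho -> ana rho B A -> pdisc rho x0 -> pdisc (rho / 2) e ->
  (forall k, ana r (rho / 4) (fun x => V x 0 k)) ->
  ana r B (fun x => A (row_mx x0 (e + V x))).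
Proof.
move=> r0 rho0 AB x0rho erho Vr.
have h j : ana r rho (fun x => row_mx x0 (e + V x) 0 j).
  case: (split_ordP j) => [i ->|k ->].
    apply: (@eq_ana _ _ _ _ (fun=> x0 0 i)) => [x _|]; first by rewrite row_mxEl.
    exact: ana_le (ltW r0) (lexx r) (x0rho i) (ana_cst m r _).
  apply: (@eq_ana _ _ _ _ (fun x => e 0 k + V x 0 k)) => [x _|].
    by rewrite row_mxEr mxE.
  apply: ana_le (ltW r0) (lexx r) _ (anaD (ana_cst m r _) (Vr k)).
  by have := erho k; lra.
apply: eq_ana (ana_comp r0 (ltW rho0) AB h) => x _; congr A.
by apply/rowP => j; rewrite !mxE.
Qed.

Lemma first_integral_pullback (F : mero_germ R (M + N)) : first_integral omega F ->
  exists f : mero_germ R kappa, mero_pullback F f H.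
Proof.
move=> FI; pose P := num F; pose Q := den F.
have [gh0 _ _] := hg.
have Hh0 : forall j, holomorphic_at (fun y : 'rV[C]_(M + N) => H y 0 j) 0.
  by apply: holo_HD; rewrite linear0.
have H0 : H 0 = 0 by exact: HD0 hg.
have [rP [BP [rP0 PB]]] := ana0_radius (num_holo F).
have [rQ [BQ [rQ0 QB]]] := ana0_radius (den_holo F).
pose rho := Num.min rP rQ.
have rho0 : 0 < rho by rewrite lt_min rP0.
have {}PB : ana rho BP P by apply: PB => //; rewrite ge_min lexx.
have {}QB : ana rho BQ Q by apply: QB => //; rewrite ge_min lexx orbT.
have rho40 : 0 < rho / 4 by rewrite divr_gt0.
have [r1 [r10 r1P]] : exists r0, 0 < r0 /\ forall r, 0 < r -> r <= r0 ->
    forall k, ana r (rho / 4) (fun y => s (H y) 0 k).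
  apply: (row_small (G := fun y => s (H y))) => // [j|].
    exact: (holo_lfun s _ Hh0).
  by rewrite H0 linear0.
have [r2 [r20 r2P]] : exists r0, 0 < r0 /\ forall r, 0 < r -> r <= r0 ->
    forall k, ana r (rho / 4) (fun t : 'rV[C]_kappa => s t 0 k).
  apply: (row_small (G := fun t => s t)) => // [j|].
    by apply: (holo_lfun s (G := id)) => i; exact: holo_coord.
  by rewrite linear0.
(* For every [y1] in this polydisc, sigma and sigma o H take it into the polydisc where P and Q
   converge. *)
pose r := Num.min (rho / 4) (Num.min r1 r2).
have r0 : 0 < r by rewrite !lt_min rho40 r10.
have rrho : r <= rho / 4 by rewrite ge_min lexx.
have rr1 : r <= r1 by rewrite !ge_min lexx orbT.
have rr2 : r <= r2 by rewrite !ge_min lexx !orbT.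
have {}r1P := r1P r r0 rr1; have {}r2P := r2P r r0 rr2.
have [r3 [r30 r3P]] := row_small Hh0 H0 r0.
have [r4 [r40 r4P]] := near_radius FI.
have [r5 [r50 r5P]] := near_radius (near_regular oh hg).
have [r6 [r60 r6P]] := invariant_WD WD oh.
(* The bound r / 2 yields the margin of the identity theorem, and [r3] keeps [H y1] within r. The
   last three make the first-integral condition, regularity and [invariant_WD] available on the
   polydisc of radius m; taking [y1] within m / 2 puts a neighbourhood of [y1] inside it. *)
pose m := Num.min (r / 2) (Num.min r3 (Num.min r4 (Num.min r5 r6))).
have m0 : 0 < m by rewrite !lt_min r30 r40 r50 r60 divr_gt0.
have mr : m <= r / 2 by rewrite ge_min lexx.
have m3 : m <= r3 by rewrite !ge_min lexx !orbT.
have m4 : m <= r4 by rewrite !ge_min lexx !orbT.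
have m5 : m <= r5 by rewrite !ge_min lexx !orbT.
have m6 : m <= r6 by rewrite !ge_min lexx !orbT.
pose d := m / 2; have d0 : 0 < d by rewrite divr_gt0.
have dm : d < m by rewrite /d; lra.
have [y1 [dy1 Qy1]] : exists y1, pdisc d y1 /\ Q y1 != 0.
  apply: contrapT => nex; apply: (@den_neq0 _ _ F); apply/nearP; exists d => //.
  move=> x dx; rewrite add0r; apply/eqP/negPn/negP => Qx.
  by apply: nex; exists x.
have ry1 : pdisc r y1 by apply: pdisc_le dy1; rewrite /d; lra.
pose x0 := lsubmx y1; pose z1 := rsubmx y1; pose t1 := H y1.
pose e := z1 - s t1; pose sigma t := row_mx x0 (e + s t).
have sigma1 : sigma (H y1) = y1 by rewrite /sigma /e subrK hsubmxK.
have x0rho : pdisc rho x0 by apply/pdisc_lsubmx; apply: pdisc_le ry1; lra.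
(* Both [z1] and [s t1] are within rho / 4. *)
have erho : pdisc (rho / 2) e.
  move=> k; rewrite !mxE (le_trans (nrmD _ _)) // nrmN.
  have := pdisc_rsubmx ry1 k; have := ana_bound (ltW r0) (r1P k) ry1.
  by rewrite mxE; lra.
have Ht A B : ana rho B A -> ana r B (fun t => A (sigma t)).
  by move=> AB; exact: (ana_row_mx r0 rho0 AB x0rho erho r2P).
have Hy A B : ana rho B A -> ana r B (fun y => A (sigma (H y))).
  by move=> AB; exact: (ana_row_mx r0 rho0 AB x0rho erho r1P).
have rt1 : pdisc r (H y1).
  by move=> j; apply: ana_bound (ltW m0) (r3P m m0 m3 j) _; apply: pdisc_le dy1; exact: ltW.
have holo0 A B : ana rho B A -> holomorphic_at (fun t => A (sigma t)) 0.
  move=> AB; apply/holoP; exists r, B; split=> //.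
  by apply: eq_ana (Ht A B AB) => t _; rewrite add0r.
(* Vanishing near 0 would spread to t = [H y1], where sigma takes the value [y1] and Q is
   nonzero. *)
have den0 : ~ (\forall t \near (0 : 'rV[C]_kappa), Q (sigma t) = 0).
  move=> Q0; have := ana_eq0 r0 (Ht Q BQ QB) Q0 rt1.
  by rewrite sigma1 => Qy10; rewrite Qy10 eqxx in Qy1.
exists (MeroGerm (holo0 P BP PB) (holo0 Q BQ QB) den0).
split=> /=.
  move=> Q0; have := ana_eq0 r0 (Hy Q BQ QB) Q0 ry1.
  by rewrite sigma1 => Qy10; rewrite Qy10 eqxx in Qy1.
pose E y := P y * Q (sigma (H y)) + -1 * (P (sigma (H y)) * Q y).
have rrho1 : r <= rho by lra.
have PBr := ana_le (ltW r0) rrho1 (lexx _) PB.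
have QBr := ana_le (ltW r0) rrho1 (lexx _) QB.
have EB := anaD (anaM r0 PBr (Hy Q BQ QB)) (anaZ (-1) (anaM r0 (Hy P BP PB) QBr)).
suff E0 : \forall y \near y1, E y = 0.
  have ddr : d + d < r by rewrite /d; lra.
  have {}E0 := ana_identity d0 ddr EB dy1 E0.
  apply/nearP; exists r => // y ry; rewrite add0r; apply/eqP.
  by rewrite -subr_eq0 -[- (_ * _)]mulN1r; apply/eqP; exact: E0.
have drho : d < rho by rewrite /d; lra.
have Ph := ana_holo PB dy1 d0 drho; have Qh := ana_holo QB dy1 d0 drho.
pose h y := P y * (Q y)^-1.
have hh : holomorphic_at h y1 by exact: (holoM Ph (holoV Qh Qy1)).
have Qn0 : \forall y \near y1, Q y != 0 by exact: (cvgr_neq0 _ (holo_continuous Qh) Qy1).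
have my : \forall y \near y1, pdisc m y by exact: (pdisc_near dy1 dm).
(* Where Q does not vanish, [h] is the holomorphic germ of the quotient, so the first-integral
   condition applies to it. *)
have inv : \forall y \near y1, invariant omega h y.
  apply: filterS3 (holo_near hh) (near_join Qn0) my => y hy Qny my a.
  rewrite pdE; apply: (r4P y (pdisc_le m4 my) h).
    split=> //; apply: filterS Qny => y' Qy'.
    by rewrite /h mulfVK.
  by rewrite /distribution /= row_mxKl row_mxKr.
have regn : \forall y \near y1, regular T g omega y.
  by apply: filterS my => y my; apply: r5P; exact: pdisc_le my.
have reg1 := nbhs_singleton regn; have [_ gh1 _] := reg1.
have invW : \forall y \near y1, forall a w, w \in W ->
    pd (row_mx a (a *m omega (lsubmx y) + w)) h y = 0.
  apply: filterS3 (filterI (holo_near hh) my) regn (near_join inv).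
  move=> y [hy my'] [oy _ _] invy a w wW.
  have -> : row_mx a (a *m omega (lsubmx y) + w) =
      row_mx a (a *m omega (lsubmx y)) + row_mx 0 w :> 'rV[C]_(M + N).
    by rewrite add_row_mx addr0.
  rewrite (pd_dirD _ _ hy) (nbhs_singleton invy) add0r.
  by apply: (r6P _ _ _ hy oy invy) => //; apply/pdisc_lsubmx/(pdisc_le m6).
have [r7 r70 r7P] := invariant_leaf reg1 hh regn invW.
(* The points y and [sigma (H y)] are compared through [y1], near which both lie; each gets half of
   [r7]. *)
have r720 : 0 < r7 / 2 by rewrite divr_gt0.
have Hh := holo_HD T gh1.
have sH : forall j, holomorphic_at (fun y => sigma (H y) 0 j) y1.
  apply: (holo_row_mx (A := fun=> x0)) => [i|k]; first exact: holo_cst.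
  rewrite (_ : (fun _ => _) = fun y => e 0 k + s (H y) 0 k).
    exact: (holoD (holo_cst _ _) (holo_lfun s k Hh)).
  by apply/funext => y; rewrite mxE.
have gs1 : forall j, holomorphic_at (fun x => g x 0 j) (lsubmx (sigma (H y1))).
  by rewrite sigma1.
have ush j := holo_comp (F := fun p => unshear p 0 j) (G := fun y => sigma (H y))
  (holo_unshear gs1 j) sH.
have near1 := holo_row_near (holo_unshear gh1) r720.
have near2 := holo_row_near (G := fun y => unshear (sigma (H y))) ush r720.
have Qsn : \forall y \near y1, Q (sigma (H y)) != 0.
  by apply: (near_comp_row (P := fun u => Q u != 0) sH); rewrite sigma1.
apply: filterS3 (filterI near1 near2) Qn0 Qsn => y [n1 n2] Qy Qsy.
rewrite sigma1 in n2.
(* The constant e was chosen with T e = g x0, so sigma is a section of H. *)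
have Hs : H y = H (sigma (H y)).
  have Te : T e = g x0.
    by rewrite /e linearB /= sectionK /t1 /HD opprB addrC subrK.
  by rewrite [RHS]/HD row_mxKl row_mxKr linearD /= sectionK Te addrAC subrr add0r.
have hs : h y = h (sigma (H y)).
  apply: r7P Hs.
    by apply: pdisc_le n2; lra.
  have -> : unshear y - unshear (sigma (H y)) =
     (unshear y - unshear y1) + - (unshear (sigma (H y)) - unshear y1).
    by rewrite opprB addrA subrK.
  by rewrite (splitr r7); apply: pdiscD n1 _; apply/pdiscN.
have /eqP := hs; rewrite /h eqr_div // => /eqP PQ.
by rewrite /E PQ mulN1r subrr.
Qed.

End Pullback.

Theorem theorem1 (R : realType) (M N : nat) (hM : (2 <= M)%N) (hN : (1 <= N)%N)
    (omega : 'rV[R[i]]_M -> 'M[R[i]]_(M, N)) (homega : holo_forms omega)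
    (W : {vspace 'rV[R[i]]_N}) (hW : is_WD omega W)
    (kappa : nat) (hkappa : kappa = (N - \dim W)%N)
    (T : 'Hom('rV[R[i]]_N, 'rV[R[i]]_kappa))
    (hTsurj : limg T = fullv) (hTker : lker T = W)
    (g : 'rV[R[i]]_M -> 'rV[R[i]]_kappa) (hg : is_primitive omega T g) :
  (forall F : mero_germ R (M + N),
     first_integral omega F <->
     exists f : mero_germ R kappa, mero_pullback F f (HD T g)) /\
  (W = fullv ->
   forall F : mero_germ R (M + N), first_integral omega F -> mero_constant F).
Proof.
have FI F : first_integral omega F ->
    exists f : mero_germ R kappa, mero_pullback F f (HD T g).
  exact: (first_integral_pullback homega hW hTsurj hTker hg).
split=> [F|Wfull F /FI[f [dn0 rel]]].
  split; first exact: FI.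
  by move=> [f Ff]; exact: (pullback_first_integral homega hg Ff).
have k0 : kappa = 0%N by rewrite hkappa Wfull dimvf dim_matrix mul1r subnn.
have v0 (u : 'rV[R[i]]_kappa) : u = 0.
  by apply/rowP => j; have := ltn_ord j; rewrite {2}k0.
(* Here ['rV_kappa] is a single point, so a denominator that is not identically zero along H is
   nonzero at 0, and f is the constant of the convention for C^0. *)
have d0 : den f 0 != 0.
  by apply/eqP => d0; apply: dn0; apply: filterE => y; rewrite (v0 (HD T g y)).
exists (num f 0 / den f 0); apply: filterS rel => y.
rewrite (v0 (HD T g y)) => rely.
by rewrite mulrAC -rely mulfK.
Qed.
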